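(* Let $\mu$ be a probability measure on a set $\mathcal{X}$ and let $k:\mathcal{X}\times\mathcal{X}\to\mathbb{R}$ be a positive-definite kernel with real RKHS $\mathcal{H}$, such that $\kappa:=\sup_{x\in\mathcal{X}}\sqrt{k(x,x)}<\infty$ and $k$ admits a Mercer expansion $k(x,y)=\sum_{j=1}^\infty \sigma_j e_j(x)e_j(y)$ for all $x,y\in\mathcal{X}$, where $(e_j)_{j\ge1}$ is an orthonormal set in $L^2(\mu)$ and $\sigma_1\ge\sigma_2\ge\cdots\ge0$. Let $N,d$ be positive integers with $6(d+1)\le N$, let $x_1,\dots,x_N\sim\mu$ be independent, and set $n_d:=\lfloor N/(6(d+1))\rfloor$. Let $T\ge0$ be an integer, let $\bm w^{(T)}$ be the output of the Frank--Wolfe procedure (described in the context) after $T$ steps, and define $Q_{N,T}(f):=\sum_{i=1}^N w_i^{(T)}f(x_i)$. Then, with probability at least $1-2^{-(d+1)}$, \[ \operatorname{wce}(Q_{N,T};\mathcal{H},\mu)\le 2\sqrt{\sum_{j>d}\sigma_j}+\frac{4\kappa}{n_d}+\frac{4\kappa}{\sqrt{T+2}}. \]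
   Context: $\Delta_N:=\{\bm w\in\mathbb{R}^N_{\ge0}:\sum_{i=1}^N w_i=1\}$ and $\bm 1_i\in\Delta_N$ denotes the $i$-th unit vector. The kernel mean embedding is $m_\mu:=\int k(x,\cdot)\,\mathrm{d}\mu(x)\in\mathcal{H}$, so $m_\mu(x_i)=\int k(x,x_i)\,\mathrm{d}\mu(x)$. The worst-case error of $Q(f)=\sum_iw_if(x_i)$ is $\operatorname{wce}(Q;\mathcal{H},\mu):=\sup_{\|f\|_{\mathcal{H}}\le1}|\int f\,\mathrm{d}\mu-Q(f)|=\|m_\mu-\sum_iw_ik(x_i,\cdot)\|_{\mathcal{H}}$. Frank--Wolfe procedure (inputs: $k$, the pool $x_1,\dots,x_N$, the values $m_\mu(x_1),\dots,m_\mu(x_N)$, and $T$): choose $i_0\in\arg\min_{i\in\{1,\dots,N\}}\bigl(k(x_i,x_i)-2m_\mu(x_i)\bigr)$ and set $\bm w^{(0)}:=\bm 1_{i_0}$. For $t=0,1,\dots,T-1$: let $h^{(t)}:=\sum_{i=1}^N w_i^{(t)}k(x_i,\cdot)$, choose $i_t\in\arg\min_{i\in\{1,\dots,N\}}\bigl(h^{(t)}(x_i)-m_\mu(x_i)\bigr)$ (any minimizer), set $\gamma_t:=2/(t+2)$ and $\bm w^{(t+1)}:=(1-\gamma_t)\bm w^{(t)}+\gamma_t\bm 1_{i_t}$. Output $\bm w^{(T)}\in\Delta_N$. *)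

(* Defs.v *)
From HB Require Import structures.
From mathcomp Require Import all_boot all_order all_algebra.
From mathcomp Require Import all_classical all_reals all_analysis.
Set Implicit Arguments. Unset Strict Implicit. Unset Printing Implicit Defensive.
Import Order.TTheory GRing.Theory Num.Theory numFieldNormedType.Exports.
Local Open Scope classical_set_scope.
Local Open Scope ring_scope.

Section Defs.
Variables (R : realType) (X : Type).

Definition pd_kernel (k : X -> X -> R) : Prop :=
  (forall x y, k x y = k y x) /\
  (forall (n : nat) (c : 'I_n -> R) (z : 'I_n -> X),
      0 <= \sum_(i < n) \sum_(j < n) c i * c j * k (z i) (z j)).

Definition is_rkhs (k : X -> X -> R) (H : set (X -> R))
    (ip : (X -> R) -> (X -> R) -> R) : Prop :=
  H (fun _ => 0) /\
      (forall (a : R) f g, H f -> H g -> H (fun x => a * f x + g x)) /\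
      (forall f g, H f -> H g -> ip f g = ip g f) /\
      (forall (a : R) f g h, H f -> H g -> H h ->
          ip (fun x => a * f x + g x) h = a * ip f h + ip g h) /\
      (forall f, H f -> 0 <= ip f f /\ (ip f f = 0 -> f = (fun _ => 0))) /\
      (forall u : nat -> X -> R, (forall n, H (u n)) ->
          (forall e : R, 0 < e -> exists M : nat, forall m n, (M <= m)%N -> (M <= n)%N ->
             ip (fun x => u m x - u n x) (fun x => u m x - u n x) < e) ->
          exists f, H f /\ forall e : R, 0 < e -> exists M : nat, forall n, (M <= n)%N ->
             ip (fun x => u n x - f x) (fun x => u n x - f x) < e) /\
      (forall x, H (k x)) /\
      (forall f x, H f -> ip f (k x) = f x).

Definition kappa (k : X -> X -> R) : R := sup (range (fun x => Num.sqrt (k x x))).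

(* Possible run of the Frank--Wolfe procedure (any choice of minimizers):
   W t is the weight vector w^(t); m i stands for m_mu(x_i). *)
Definition fw_run (N : nat) (k : X -> X -> R) (xs : 'I_N -> X) (m : 'I_N -> R)
    (W : nat -> 'I_N -> R) (T : nat) : Prop :=
  (exists i0 : 'I_N,
      (forall i, k (xs i0) (xs i0) - 2 * m i0 <= k (xs i) (xs i) - 2 * m i) /\
      W 0%N = (fun j => (j == i0)%:R)) /\
  (forall t : nat, (t < T)%N ->
     let h := fun y => \sum_(j < N) W t j * k (xs j) y in
     let g := 2 / (t%:R + 2) in
     exists it : 'I_N,
       (forall i, h (xs it) - m it <= h (xs i) - m i) /\
       W t.+1 = (fun j => (1 - g) * W t j + g * (j == it)%:R)).

End Defs.

Section Meas.
Local Open Scope ereal_scope.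
Context (R : realType) (d : measure_display) (X : measurableType d).

Definition kme (mu : probability X R) (k : X -> X -> R) (y : X) : R :=
  fine (\int[mu]_x (k x y)%:E).

Definition wce (mu : probability X R) (H : set (X -> R))
    (ip : (X -> R) -> (X -> R) -> R) (N : nat) (xs : 'I_N -> X) (w : 'I_N -> R)
    : \bar R :=
  ereal_sup [set `| \int[mu]_x (f x)%:E - (\sum_(i < N) w i * f (xs i))%:E |
            | f in [set f | H f /\ (ip f f <= 1)%R]].

Definition orthonormal_L2 (mu : probability X R) (e : nat -> X -> R) : Prop :=
  (forall j, measurable_fun setT (e j)) /\
  (forall i j, \int[mu]_x (e i x * e j x)%:E = ((i == j)%:R)%:E).

Definition iid_with_law {dO : measure_display} {Omega : measurableType dO}
    (P : probability Omega R) (mu : probability X R) (N : nat)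
    (Xs : 'I_N -> Omega -> X) : Prop :=
  (forall i, measurable_fun setT (Xs i)) /\
  (forall A : 'I_N -> set X, (forall i, measurable (A i)) ->
     P [set om | forall i, A i (Xs i om)] = \prod_(i < N) mu (A i)).

End Meas.

(* Main.v *)
Require Import Defs.
From HB Require Import structures.
From mathcomp Require Import all_boot all_order all_algebra.
From mathcomp Require Import all_classical all_reals all_analysis.
From mathcomp Require Import measurable_realfun ring lra.
Import Order.TTheory GRing.Theory Num.Theory numFieldNormedType.Exports.
Set Implicit Arguments.
Unset Strict Implicit.
Unset Printing Implicit Defensive.
Local Open Scope classical_set_scope.
Local Open Scope ring_scope.

(* The squared worst-case error of convex weights is the squared distance from the embedding of mu
   to a convex combination of kernel sections. Its value along the Frank-Wolfe run contracts, up to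
   4 kappa^2 gamma^2 per step, towards its value at any competing convex weights, which bounds the
   worst-case error of the output by theirs plus 4 kappa / sqrt(T + 2). It remains to find good
   convex weights.

   Map x to the vector of its first d Mercer features together with the norm of the remaining
   ones: it lives in dimension D = d + 1 and has norm at most kappa. If a convex combination of the
   sampled vectors is within beta of the mean vector, its worst-case error is at most
   2 sqrt(sum_{j>d} sigma_j) + beta. By Markov, every half-space at distance 2 kappa / n beyond the
   mean has mass at most n / (n + 1).

   Suppose the hull of the centred sample stays away from 0. Its point nearest to 0 is a convex
   combination of at most D sample points, and it is already the nearest point for every subsample
   containing them. Split the sample into 2D blocks of at least 3n points: some D blocks determine
   a half-space containing all the points of the other blocks, so a union bound over the choices
   of blocks gives failure probability at most 4^D (n / (n + 1))^(3nD) <= 2^(-D). Rounding the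
   vectors to a finite grid, at the cost of kappa / n twice in the distance, makes this a finite
   computation with product weights, so that neither a measurable selection of the nearest point
   nor Fubini is needed. *)

Section LinearCombinations.
Variable R : realDomainType.

Definition dot (J : finType) (u v : J -> R) : R := \sum_i u i * v i.

Definition comb (J : finType) (I : Type) (w : J -> R) (F : J -> I -> R) : I -> R :=
  fun x => dot w (F^~ x).

Lemma dotC (J : finType) (u v : J -> R) : dot u v = dot v u.
Proof. by apply: eq_bigr => i _; rewrite mulrC. Qed.

Lemma dot_linear_l (J : finType) (a : R) (u v z : J -> R) :
  dot (fun i => a * u i + v i) z = a * dot u z + dot v z.
Proof. by rewrite /dot mulr_sumr -big_split; apply: eq_bigr => i _; rewrite mulrDl mulrA. Qed.

Lemma dotBr (J : finType) (u v z : J -> R) : dot u (fun i => v i - z i) = dot u v - dot u z.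
Proof. by rewrite /dot -sumrB; apply: eq_bigr => i _; rewrite mulrBr. Qed.

Lemma dot_combr (J I : finType) (u : I -> R) (w : J -> R) (F : J -> I -> R) :
  dot u (comb w F) = dot w (fun i => dot u (F i)).
Proof.
rewrite /dot; under eq_bigr do rewrite mulr_sumr.
rewrite exchange_big; apply: eq_bigr => i _; rewrite mulr_sumr.
by apply: eq_bigr => j _; rewrite mulrCA.
Qed.

Lemma dot_self_ge0 (J : finType) (u : J -> R) : 0 <= dot u u.
Proof. by apply: sumr_ge0 => i _; rewrite -expr2 sqr_ge0. Qed.

Lemma dot_self_eq0 (J : finType) (u : J -> R) : dot u u = 0 -> u = fun=> 0.
Proof.
move=> uu; apply/funext => i.
have sq_ge0 j : true -> 0 <= u j * u j by rewrite -expr2 sqr_ge0.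
have {}uu : u i * u i = 0 by apply: (psumr_eq0P sq_ge0 uu).
by move: uu => /eqP; rewrite mulf_eq0 orbb => /eqP.
Qed.

Definition simplex (J : finType) (w : J -> R) : Prop := (forall i, 0 <= w i) /\ \sum_i w i = 1.

Definition vertex (J : finType) (i : J) : J -> R := fun j => (j == i)%:R.

Lemma dot_vertexl (J : finType) (i : J) (f : J -> R) : dot (vertex i) f = f i.
Proof.
rewrite /dot (bigD1 i) //= /vertex eqxx mul1r big1 ?addr0 // => j /negPf ->.
by rewrite mul0r.
Qed.

Lemma simplex_vertex (J : finType) (i : J) : simplex (vertex i).
Proof.
split=> [j|]; first exact: ler0n.
by have := dot_vertexl i (fun=> 1); rewrite /dot; under eq_bigr do rewrite mulr1.
Qed.

Lemma simplex_mix (J : finType) (g : R) (u v : J -> R) : 0 <= g <= 1 ->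
  simplex u -> simplex v -> simplex (fun i => (1 - g) * u i + g * v i).
Proof.
move=> /andP[g0 g1] [u0 u1] [v0 v1]; split=> [i|].
  by rewrite addr_ge0 ?mulr_ge0 ?subr_ge0.
by rewrite big_split /= -!mulr_sumr u1 v1 !mulr1 subrK.
Qed.

Section SimplexAverage.
Variables (J : finType) (w : J -> R).
Hypothesis w_simplex : simplex w.

Lemma dot_simplex_cst (c : R) : dot w (fun=> c) = c.
Proof. by rewrite /dot -mulr_suml; case: w_simplex => _ ->; rewrite mul1r. Qed.

Lemma ler_dot_simplex (f g : J -> R) : (forall i, f i <= g i) -> dot w f <= dot w g.
Proof. by case: w_simplex => w0 _ fg; apply: ler_sum => i _; rewrite ler_wpM2l. Qed.

Lemma dot_simplex_le (f : J -> R) (c : R) : (forall i, f i <= c) -> dot w f <= c.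
Proof. by move=> fc; rewrite -[leRHS]dot_simplex_cst; exact: ler_dot_simplex. Qed.

Lemma dot_simplex_ge (f : J -> R) (c : R) : (forall i, c <= f i) -> c <= dot w f.
Proof. by move=> fc; rewrite -[leLHS]dot_simplex_cst; exact: ler_dot_simplex. Qed.

Lemma dot_simplex_norm_le (f : J -> R) (c : R) : (forall i, `|f i| <= c) -> `|dot w f| <= c.
Proof.
move=> fc; have fc' i : - c <= f i <= c by rewrite -ler_norml.
by rewrite ler_norml dot_simplex_ge ?dot_simplex_le // => i; case/andP: (fc' i).
Qed.

End SimplexAverage.

End LinearCombinations.

Arguments vertex {R J} i j.
Arguments simplex_vertex {R J} i.

Section SemiInnerProduct.
Variables (R : realFieldType) (I : Type).

Definition linear_subspace (H : set (I -> R)) : Prop :=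
  H (fun=> 0) /\ forall a f g, H f -> H g -> H (fun x => a * f x + g x).

Record semi_inner_product (H : set (I -> R)) (ip : (I -> R) -> (I -> R) -> R) : Prop := {
  sip_subspace : linear_subspace H;
  sip_sym : forall f g, H f -> H g -> ip f g = ip g f;
  sip_linear_l : forall a f g h, H f -> H g -> H h ->
    ip (fun x => a * f x + g x) h = a * ip f h + ip g h;
  sip_ge0 : forall f, H f -> 0 <= ip f f }.

Lemma linear_subspaceB H f g :
  linear_subspace H -> H f -> H g -> H (fun x => f x - g x).
Proof.
move=> [_ Hlin] Hf Hg; have -> : (fun x => f x - g x) = (fun x => -1 * g x + f x).
  by apply/funext => x; rewrite mulN1r addrC.
exact: Hlin.
Qed.

Lemma linear_subspace_comb H (J : finType) (w : J -> R) (F : J -> I -> R) :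
  linear_subspace H -> (forall i, H (F i)) -> H (comb w F).
Proof.
move=> [H0 Hlin] HF; rewrite /comb /dot; elim: (index_enum J) => [|i r IH].
  by under eq_fun do rewrite big_nil.
by under eq_fun do rewrite big_cons; exact: Hlin.
Qed.

Lemma discriminant_le (a b c : R) :
  0 <= a -> (forall t, 0 <= t ^+ 2 * a + 2 * t * b + c) -> b ^+ 2 <= a * c.
Proof.
move=> a0 quad_ge0; have [aE|aN] := eqVneq a 0.
  rewrite aE mul0r; have [->|bN] := eqVneq b 0; first by rewrite expr0n.
  have := quad_ge0 (- (c + 1) / (2 * b)); rewrite aE mulr0 add0r.
  have -> : 2 * (- (c + 1) / (2 * b)) * b = - (c + 1) by field.
  lra.
have a_gt0 : 0 < a by rewrite lt_def aN.
have := quad_ge0 (- b / a).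
have -> : (- b / a) ^+ 2 * a + 2 * (- b / a) * b + c = (a * c - b ^+ 2) / a by field.
by rewrite pmulr_lge0 ?invr_gt0 // subr_ge0.
Qed.

Variables (H : set (I -> R)) (ip : (I -> R) -> (I -> R) -> R).
Hypothesis sip : semi_inner_product H ip.
Let Hlin a f g : H f -> H g -> H (fun x => a * f x + g x).
Proof. by have [_] := sip_subspace sip; exact. Qed.
Let HB f g : H f -> H g -> H (fun x => f x - g x).
Proof. exact: linear_subspaceB (sip_subspace sip). Qed.

Lemma sip_linear_r a f g h : H f -> H g -> H h ->
  ip h (fun x => a * f x + g x) = a * ip h f + ip h g.
Proof.
by move=> Hf Hg Hh; rewrite !(sip_sym sip Hh) ?(sip_linear_l sip) //; exact: Hlin.
Qed.

Lemma sip_linear_self a f g : H f -> H g ->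
  ip (fun x => a * f x + g x) (fun x => a * f x + g x) =
  a ^+ 2 * ip f f + 2 * a * ip f g + ip g g.
Proof.
move=> Hf Hg; have Hh := Hlin a Hf Hg.
rewrite (sip_linear_l sip) // !sip_linear_r // (sip_sym sip Hg Hf); ring.
Qed.

Lemma sipBl f g h : H f -> H g -> H h -> ip (fun x => f x - g x) h = ip f h - ip g h.
Proof.
move=> Hf Hg Hh; have -> : (fun x => f x - g x) = (fun x => -1 * g x + f x).
  by apply/funext => x; rewrite mulN1r addrC.
by rewrite (sip_linear_l sip) // mulN1r addrC.
Qed.

Lemma sipBr f g h : H f -> H g -> H h -> ip h (fun x => f x - g x) = ip h f - ip h g.
Proof.
by move=> Hf Hg Hh; rewrite !(sip_sym sip Hh) // ?sipBl //; exact: HB.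
Qed.

Lemma sipB_self f g : H f -> H g ->
  ip (fun x => f x - g x) (fun x => f x - g x) = ip f f - 2 * ip f g + ip g g.
Proof.
move=> Hf Hg; rewrite sipBl ?sipBr //; last exact: HB.
rewrite (sip_sym sip Hg Hf); ring.
Qed.

Lemma sip_comb_l (J : finType) (w : J -> R) (F : J -> I -> R) h : (forall i, H (F i)) -> H h ->
  ip (comb w F) h = dot w (fun i => ip (F i) h).
Proof.
move=> HF Hh; have [H0 _] := sip_subspace sip; rewrite /comb /dot.
suff [] : H (fun x => \sum_i w i * F i x) /\
    ip (fun x => \sum_i w i * F i x) h = \sum_i w i * ip (F i) h by [].
elim: (index_enum J) => [|i r [Hr IH]]; last first.
  under eq_fun do rewrite big_cons; rewrite big_cons (sip_linear_l sip) // IH.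
  by split=> //; exact: Hlin.
under eq_fun do rewrite big_nil; split=> //; rewrite big_nil.
have -> : (fun=> 0) = (fun x => h x - h x) by apply/funext => x; rewrite subrr.
by rewrite sipBl // subrr.
Qed.

Lemma sip_comb_r (J : finType) (w : J -> R) (F : J -> I -> R) h : (forall i, H (F i)) -> H h ->
  ip h (comb w F) = dot w (fun i => ip h (F i)).
Proof.
move=> HF Hh; have HwF : H (comb w F) by exact: linear_subspace_comb (sip_subspace sip) HF.
by rewrite (sip_sym sip) // sip_comb_l //; apply: eq_bigr => i _; rewrite (sip_sym sip).
Qed.

Definition sqdist (f g : I -> R) : R := ip (fun x => f x - g x) (fun x => f x - g x).

Lemma sqdist_ge0 f g : H f -> H g -> 0 <= sqdist f g.
Proof. by move=> Hf Hg; apply/(sip_ge0 sip)/HB. Qed.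

Lemma cauchy_schwarz f g : H f -> H g -> ip f g ^+ 2 <= ip f f * ip g g.
Proof.
move=> Hf Hg; apply: discriminant_le => [|t]; first exact: (sip_ge0 sip).
by rewrite -sip_linear_self //; apply/(sip_ge0 sip)/Hlin.
Qed.

Section NormBounds.
Variables (f g : I -> R) (a b : R).
Hypotheses (Hf : H f) (Hg : H g) (a_ge0 : 0 <= a) (b_ge0 : 0 <= b).
Hypotheses (f_le : ip f f <= a ^+ 2) (g_le : ip g g <= b ^+ 2).

Lemma cauchy_schwarz_le : `|ip f g| <= a * b.
Proof.
rewrite -(ler_pXn2r (ltn0Sn 1)) ?nnegrE ?mulr_ge0 // real_normK ?num_real //.
apply: le_trans (cauchy_schwarz Hf Hg) _; rewrite exprMn.
by apply: ler_pM => //; exact: (sip_ge0 sip).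
Qed.

Lemma sip_add_self_le :
  ip (fun x => f x + g x) (fun x => f x + g x) <= (a + b) ^+ 2.
Proof.
have -> : (fun x => f x + g x) = (fun x => 1 * f x + g x).
  by apply/funext => x; rewrite mul1r.
rewrite sip_linear_self // expr1n mul1r mulr1 sqrrD.
by have := cauchy_schwarz_le; rewrite ler_norml => /andP[_]; move: f_le g_le; lra.
Qed.

Lemma sipB_self_le :
  ip (fun x => f x - g x) (fun x => f x - g x) <= (a + b) ^+ 2.
Proof.
rewrite sipB_self // sqrrD.
by have := cauchy_schwarz_le; rewrite ler_norml => /andP[+ _]; move: f_le g_le; lra.
Qed.

End NormBounds.

Lemma sip_comb_self_le (J : finType) (w : J -> R) (F : J -> I -> R) (a : J -> R) :
  simplex w -> (forall i, H (F i)) -> (forall i, 0 <= a i) ->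
  (forall i, ip (F i) (F i) <= a i ^+ 2) -> ip (comb w F) (comb w F) <= dot w a ^+ 2.
Proof.
move=> ws HF a0 Fa; have HwF := linear_subspace_comb w (sip_subspace sip) HF.
rewrite sip_comb_l // expr2 {3}/dot mulr_suml; apply: ler_sum => i _.
case: (ws) => w0 _; rewrite -mulrA ler_wpM2l // sip_comb_r // mulr_sumr.
apply: ler_sum => j _; rewrite mulrCA ler_wpM2l //.
exact: le_trans (ler_norm _) (cauchy_schwarz_le (HF i) (HF j) (a0 i) (a0 j) (Fa i) (Fa j)).
Qed.

End SemiInnerProduct.

Section ConcreteSemiInnerProducts.
Variable R : realFieldType.

Lemma dot_sip (J : finType) : semi_inner_product [set: J -> R] (@dot R J).
Proof.
split=> // [f g _ _|a f g h _ _ _|f _]; [exact: dotC|exact: dot_linear_l|exact: dot_self_ge0].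
Qed.

Definition qform (J : finType) (G : J -> J -> R) (u v : J -> R) : R :=
  dot u (fun i => dot v (G i)).

Lemma qform_sip (J : finType) (G : J -> J -> R) :
  (forall i j, G i j = G j i) -> (forall u, 0 <= qform G u u) ->
  semi_inner_product [set: J -> R] (qform G).
Proof.
move=> G_sym G_psd; split=> // [u v _ _|a u v z _ _ _]; last exact: dot_linear_l.
rewrite /qform /dot; under eq_bigr do rewrite mulr_sumr.
rewrite exchange_big; apply: eq_bigr => j _; rewrite mulr_sumr.
by apply: eq_bigr => i _; rewrite mulrCA G_sym.
Qed.

Definition wdot (I : Type) (s : I -> R) (r : seq I) (u v : I -> R) : R :=
  \sum_(j <- r) s j * u j * v j.

Lemma wdot_sip (I : Type) (s : I -> R) (r : seq I) : (forall j, 0 <= s j) ->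
  semi_inner_product [set: I -> R] (wdot s r).
Proof.
move=> s0; split=> // [u v _ _|a u v z _ _ _|u _].
- by apply: eq_bigr => j _; rewrite mulrAC.
- rewrite /wdot mulr_sumr -big_split; apply: eq_bigr => j _ /=; ring.
- by apply: sumr_ge0 => j _; rewrite -mulrA -expr2 mulr_ge0 // sqr_ge0.
Qed.

End ConcreteSemiInnerProducts.

Section NearestPointOfConvexHull.
Variable R : realFieldType.

Definition nearest_in_hull (J I : finType) (y : J -> I -> R) (K : {set J}) (p : I -> R) : Prop :=
  (exists w, [/\ simplex w, forall i, i \notin K -> w i = 0 & p = comb w y]) /\
  forall i, i \in K -> dot p p <= dot p (y i).

Lemma nearest_in_hull_le_dot (J I : finType) (y : J -> I -> R) (K : {set J}) p (w : J -> R) :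
  nearest_in_hull y K p -> simplex w -> (forall i, i \notin K -> w i = 0) ->
  dot p p <= dot p (comb w y).
Proof.
move=> [_ py] ws wK; rewrite dot_combr -[leLHS](dot_simplex_cst ws).
case: ws => w0 _; apply: ler_sum => i _.
by have [iK|/wK ->] := boolP (i \in K); rewrite ?mul0r // ler_wpM2l // py.
Qed.

Lemma nearest_in_hull_uniq (J I : finType) (y : J -> I -> R) (K : {set J}) p p' :
  nearest_in_hull y K p -> nearest_in_hull y K p' -> p = p'.
Proof.
move=> pP p'P; have pp' : dot p p <= dot p p'.
  by case: (p'P) => -[w [ws wK ->]] _; exact: nearest_in_hull_le_dot pP ws wK.
have p'p : dot p' p' <= dot p' p.
  by case: (pP) => -[w [ws wK ->]] _; exact: nearest_in_hull_le_dot p'P ws wK.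
have /dot_self_eq0 pB : dot (fun j => p j - p' j) (fun j => p j - p' j) = 0.
  apply/eqP; rewrite eq_le dot_self_ge0 andbT (sipB_self (dot_sip _ _)) //.
  by rewrite (dotC p' p) in p'p; lra.
by apply/funext => j; apply/eqP; rewrite -subr_eq0 (congr1 (@^~ j) pB).
Qed.

Lemma eq_nearest_in_hull (J I : finType) (y y' : J -> I -> R) (K : {set J}) p :
  (forall i, i \in K -> y i = y' i) -> nearest_in_hull y K p -> nearest_in_hull y' K p.
Proof.
move=> yy' [[w [ws wK pw]] py]; split=> [|i iK]; last by rewrite -yy' // py.
exists w; split=> //; rewrite pw; apply/funext => j; apply: eq_bigr => i _.
by have [/yy' ->|/wK ->] := boolP (i \in K); rewrite ?mul0r.
Qed.

Lemma linear_dependence (J I : finType) (y : J -> I -> R) (S : {set J}) : (#|I| < #|S|)%N ->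
  exists a : J -> R, [/\ forall i, i \notin S -> a i = 0, exists i, a i != 0 & comb a y = fun=> 0].
Proof.
move=> IS; pose A : 'M[R]_(#|S|, #|I|) := \matrix_(l, j) y (enum_val l) (enum_val j).
have : kermx A != 0.
  by rewrite kermx_eq0 /row_free neq_ltn (leq_ltn_trans (rank_leq_col _)).
case/rowV0Pn => u /sub_kermxP uA u_neq0.
pose a i : R := \sum_l u ord0 l * vertex (enum_val l) i.
have dot_a f : dot a f = \sum_l u ord0 l * f (enum_val l).
  rewrite /dot; under eq_bigr do rewrite mulr_suml.
  rewrite exchange_big; apply: eq_bigr => l _ /=.
  by rewrite -(dot_vertexl _ f) /dot mulr_sumr; apply: eq_bigr => i _; rewrite mulrA.
exists a; split=> [i iS||].
- rewrite /a big1 // => l _; rewrite /vertex; case: eqP => [il|]; last by rewrite mulr0.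
  by move: iS; rewrite il enum_valP.
- have [l ul] : exists l, u ord0 l != 0.
    apply/existsP; rewrite -negb_forall; apply: contra u_neq0 => /forallP u0.
    by apply/eqP/rowP => l; rewrite mxE; exact/eqP.
  exists (enum_val l); rewrite /a (bigD1 l) //= /vertex eqxx mulr1 big1 ?addr0 // => m ml.
  by rewrite (inj_eq enum_val_inj) eq_sym (negPf ml) mulr0.
- apply/funext => j; have := congr1 (fun B : 'rV[R]_#|I| => B ord0 (enum_rank j)) uA.
  rewrite /comb dot_a !mxE => uAj; rewrite -[RHS]uAj.
  by apply: eq_bigr => l _; rewrite mxE enum_rankK.
Qed.

Definition wsupp (J : finType) (w : J -> R) : {set J} := [set i | w i != 0]%SET.

(* Moving from [w] along [- a] until the first weight vanishes. *)
Lemma simplex_reduce (J : finType) (w a : J -> R) :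
  simplex w -> wsupp a \subset wsupp w -> (exists i, a i != 0) -> \sum_i a i = 0 ->
  exists t, simplex (fun i => w i - t * a i) /\
    wsupp (fun i => w i - t * a i) \proper wsupp w.
Proof.
move=> [w0 w1] aw [i0 ai0] a_sum0.
have [i1 ai1] : exists i, 0 < a i.
  apply: contrapT => /forallNP a_le0.
  have a_opp_ge0 i : true -> 0 <= - a i by rewrite oppr_ge0 leNgt => _; apply/negP/a_le0.
  have : \sum_i - a i = 0 by rewrite sumrN a_sum0 oppr0.
  by move/(psumr_eq0P a_opp_ge0)/(_ i0 isT)/eqP; rewrite oppr_eq0 (negPf ai0).
have [m am m_min] := @arg_minP _ _ _ i1 (fun i => 0 < a i) (fun i => w i / a i) ai1.
pose t := w m / a m; have t_ge0 : 0 <= t by rewrite divr_ge0 // ltW.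
exists t; split; first split=> [i|].
- rewrite subr_ge0; have [ai|ai] := ltP 0 (a i); first by rewrite -ler_pdivlMr // m_min.
  by rewrite (le_trans _ (w0 i)) // mulr_ge0_le0.
- by rewrite sumrB -mulr_sumr a_sum0 mulr0 subr0.
apply/properP; split.
  apply/fintype.subsetP => i; apply: contraLR => iw.
  have ia : i \notin wsupp a by apply: contra iw; exact: (fintype.subsetP aw).
  by move: iw ia; rewrite !inE !negbK => /eqP -> /eqP ->; rewrite mulr0 subr0.
exists m; first by apply: (fintype.subsetP aw); rewrite inE gt_eqF.
by rewrite inE negbK /t divfK ?(gt_eqF am) // subrr.
Qed.

Lemma nearest_in_hull_tight (J I : finType) (y : J -> I -> R) (w : J -> R) :
  simplex w -> nearest_in_hull y [set: J]%SET (comb w y) ->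
  forall i, i \in wsupp w -> dot (comb w y) (y i) = dot (comb w y) (comb w y).
Proof.
move=> [w0 w1] [_ py] i; rewrite inE => wi; set p := comb w y in py *.
have gap_ge0 j : true -> 0 <= w j * (dot p (y j) - dot p p).
  by rewrite mulr_ge0 // subr_ge0 py ?inE.
have gap_sum0 : \sum_j w j * (dot p (y j) - dot p p) = 0.
  under eq_bigr do rewrite mulrBr.
  by rewrite sumrB -mulr_suml w1 mul1r -[X in X - _]/(dot w _) -dot_combr -/p subrr.
have /eqP := psumr_eq0P gap_ge0 gap_sum0 (isT : true) (i := i).
by rewrite mulf_eq0 (negPf wi) subr_eq0 => /eqP.
Qed.

(* All the points carrying weight lie on the hyperplane [dot p z = dot p p], which misses 0;
   hence Caratheodory's bound is [#|I|] rather than [#|I|.+1]. *)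
Lemma nearest_in_hull_caratheodory (J I : finType) (y : J -> I -> R) (p : I -> R) :
  nearest_in_hull y [set: J]%SET p -> 0 < dot p p ->
  exists2 S : {set J}, (#|S| <= #|I|)%N &
    forall K : {set J}, S \subset K -> nearest_in_hull y K p.
Proof.
move=> pP p_gt0; have [[w [ws _ pw]] py] := pP.
suff [v [vs pv vI]] : exists v, [/\ simplex v, p = comb v y & (#|wsupp v| <= #|I|)%N].
  exists (wsupp v) => // K vK; split=> [|i _]; last by rewrite py ?inE.
  exists v; split=> // i; apply: contraNeq => vi.
  by apply: (fintype.subsetP vK); rewrite inE.
have [n] := ubnP #|wsupp w|; elim: n w ws pw => // n IH w ws pw wn.
have [wI|Iw] := leqP #|wsupp w| #|I|; first by exists w.
have [a [aw a_neq0 ay]] := linear_dependence y Iw.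
have tight i : i \in wsupp w -> dot p (y i) = dot p p.
  by rewrite pw in pP *; exact: nearest_in_hull_tight.
have a_sum0 : \sum_i a i = 0.
  have : dot a (fun i => dot p (y i)) = (\sum_i a i) * dot p p.
    rewrite mulr_suml; apply: eq_bigr => i _.
    by have [/tight ->|/aw ->] := boolP (i \in wsupp w); rewrite ?mul0r.
  rewrite -dot_combr ay /dot big1 => [|j _]; last by rewrite mulr0.
  by move/esym/eqP; rewrite mulf_eq0 (gt_eqF p_gt0) orbF => /eqP.
have a_supp : wsupp a \subset wsupp w.
  by apply/fintype.subsetP => i; rewrite inE; apply: contraNT => /aw ->.
have [t [w's /proper_card w'n]] := simplex_reduce ws a_supp a_neq0 a_sum0.
apply: (IH _ w's); last by apply: leq_trans w'n _; rewrite -ltnS.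
apply/funext => j; have aj : dot a (y^~ j) = 0 := congr1 (@^~ j) ay.
have -> : (fun i => w i - t * a i) = (fun i => - t * a i + w i).
  by apply/funext => i; rewrite mulNr addrC.
by rewrite /comb dot_linear_l aj mulr0 add0r pw.
Qed.

End NearestPointOfConvexHull.

Lemma ge0_of_quadratic_ge0 (R : realFieldType) (a b : R) :
  0 <= b -> (forall t, 0 <= t <= 1 -> 0 <= t ^+ 2 * b + 2 * t * a) -> 0 <= a.
Proof.
move=> b0 quad_ge0; rewrite leNgt; apply/negP => a0; have ba : 0 < b - a by lra.
have t01 : 0 <= - a / (b - a) <= 1.
  by rewrite divr_ge0 ?(ltW ba) ?oppr_ge0 ?(ltW a0) // ler_pdivrMr //; lra.
have := quad_ge0 _ t01.
have -> : (- a / (b - a)) ^+ 2 * b + 2 * (- a / (b - a)) * a =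
    a ^+ 2 * (2 * a - b) / (b - a) ^+ 2 by field; rewrite gt_eqF.
rewrite pmulr_lge0 ?invr_gt0 ?exprn_gt0 // pmulr_rge0; last by rewrite exprn_even_gt0 //= lt_eqF.
lra.
Qed.

Lemma comb_mix_vertex (R : realDomainType) (J : finType) (I : Type) (g : R) (w : J -> R) (i : J)
    (y : J -> I -> R) :
  comb (fun j => (1 - g) * w j + g * vertex i j) y = fun x => g * (y i x - comb w y x) + comb w y x.
Proof.
apply/funext => x; rewrite /comb dot_linear_l.
have -> : dot (fun j => g * vertex i j) (y^~ x) = g * y i x.
  by rewrite -(dot_vertexl i (y^~ x)) /dot mulr_sumr; apply: eq_bigr => j _; rewrite mulrA.
ring.
Qed.

Section ExistenceOfNearestPoint.
Variable R : realType.

Lemma compact_simplex (J : finType) : compact [set w : {ptws J -> R} | simplex w].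
Proof.
have cube_compact : compact [set w : {ptws J -> R} | forall i, `[0, 1]%classic (w i)].
  exact: (@tychonoff J (fun=> R) _ (fun=> @segment_compact R 0 1)).
apply: subclosed_compact cube_compact _ => [|w [w0 w1] i /=]; last first.
  by rewrite in_itv /= w0 -w1 (bigD1 i) //= lerDl sumr_ge0.
have -> : [set w : {ptws J -> R} | simplex w] =
    \bigcap_(i in [set: J]) ((fun w : {ptws J -> R} => w i) @^-1` [set x | 0 <= x])
    `&` ((fun w : {ptws J -> R} => \sum_i w i) @^-1` [set 1]).
  apply/seteqP; split=> w /= [w0 w1]; split=> // i; [by move=> _; exact: w0|exact: w0].
apply: closedI; first (apply: closed_bigI => i _; apply: preimage_closed; last exact: closed_ge).
  by move=> w _; exact: proj_continuous.
apply: preimage_closed; last exact: closed_eq.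
by move=> w _; apply: continuous_big => [|i _]; [exact: add_continuous|exact: proj_continuous].
Qed.

Lemma continuous_comb_norm (J I : finType) (y : J -> I -> R) :
  continuous (fun w : {ptws J -> R} => dot (comb w y) (comb w y)).
Proof.
have comb_cont j : continuous (fun w : {ptws J -> R} => comb w y j).
  apply: continuous_big => [|i _ w]; first exact: add_continuous.
  by apply: (@continuousM R {ptws J -> R} (@^~ i) (cst (y i j)));
    [exact: proj_continuous|exact: cst_continuous].
apply: continuous_big => [|j _ w]; first exact: add_continuous.
exact: (continuousM (comb_cont j w) (comb_cont j w)).
Qed.

Lemma nearest_in_hull_exists (J I : finType) (y : J -> I -> R) : (0 < #|J|)%N ->
  exists p, nearest_in_hull y [set: J]%SET p.
Proof.
move=> /card_gt0P[i0 _]; have simplex_neq0 : [set w : {ptws J -> R} | simplex w] !=set0.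
  by exists (vertex i0); exact: simplex_vertex.
have [w /set_mem /= ws w_min] := compact_EVT_min simplex_neq0 (@compact_simplex J)
  (continuous_subspaceT (@continuous_comb_norm J I y)).
set p := comb w y in w_min *; exists p; split=> [|i _].
  by exists w; split=> // i; rewrite inE.
pose z j := y i j - p j; have pz : dot z p = dot p (y i) - dot p p by rewrite dotC dotBr.
rewrite -subr_ge0 -pz; apply: (ge0_of_quadratic_ge0 (dot_self_ge0 z)) => t t01.
have := w_min _ (mem_set (simplex_mix t01 ws (simplex_vertex i))).
by rewrite comb_mix_vertex -/p -/z (sip_linear_self (dot_sip R I)) // lerDr.
Qed.

End ExistenceOfNearestPoint.

Section FiniteSampling.
Variables (R : realDomainType) (F J : finType) (p : F -> R).
Hypotheses (p_ge0 : forall v, 0 <= p v) (p_sum1 : \sum_v p v = 1).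

Definition sample_prob (Q : pred {ffun J -> F}) : R := \sum_(s | Q s) \prod_i p (s i).

Lemma sample_probT : sample_prob predT = 1.
Proof. by rewrite /sample_prob -(bigA_distr_bigA (fun _ => p)) big1. Qed.

Lemma sample_probC Q : sample_prob Q = 1 - sample_prob (predC Q).
Proof. by rewrite -sample_probT /sample_prob [X in _ = X - _](bigID Q) addrK. Qed.

Lemma sample_prob_mono (Q Q' : pred {ffun J -> F}) :
  (forall s, Q s -> Q' s) -> sample_prob Q <= sample_prob Q'.
Proof.
move=> QQ'; rewrite /sample_prob big_mkcond [leRHS]big_mkcond; apply: ler_sum => s _.
by case: ifP => [/QQ' ->//|_]; case: ifP => // _; exact: prodr_ge0.
Qed.

Lemma sample_prob_union_bound (B : finType) (P : pred B) (Q : pred {ffun J -> F})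
    (E : B -> pred {ffun J -> F}) :
  (forall s, Q s -> exists2 K, P K & E K s) ->
  sample_prob Q <= \sum_(K | P K) sample_prob (E K).
Proof.
move=> QE; rewrite /sample_prob (exchange_big_dep predT) //= big_mkcond; apply: ler_sum => s _.
have sum_ge0 (C : pred B) : 0 <= \sum_(K | C K) \prod_i p (s i).
  by apply: sumr_ge0 => _ _; exact: prodr_ge0.
by case: ifP => // /QE[K PK EK]; rewrite (bigD1 K) ?PK //= lerDl.
Qed.

Definition cylinder (K : {set J}) (t : {ffun J -> F}) (B : pred F) : pred {ffun J -> F} :=
  fun s => [forall i, if i \in K then s i == t i else B (s i)].

Lemma sample_prob_cylinder K t B :
  sample_prob (cylinder K t B) = (\sum_(v | B v) p v) ^+ #|~: K| * \prod_(i in K) p (t i).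
Proof.
pose side i : pred F := fun v => if i \in K then v == t i else B v.
transitivity (\prod_i \sum_(v | side i v) p v).
  rewrite (bigA_distr_big_dep side (fun _ => p)); apply: eq_bigl => s.
  exact: eq_forallb.
rewrite (bigID (mem K)) /= mulrC; congr (_ * _).
  rewrite -prodr_const; apply: eq_big => [i|i iK]; first by rewrite inE.
  by apply: eq_bigl => v; rewrite /side (negPf iK).
by apply: eq_bigr => i iK; rewrite (big_pred1 (t i)) // => v; rewrite /side iK.
Qed.

(* Conditionally on the coordinates in [K] the set [A s] is fixed, and the other coordinates hit
   it independently. *)
Lemma sample_prob_conditional_le (K : {set J}) (A : {ffun J -> F} -> pred F) (q : R) :
  (forall s s' : {ffun J -> F}, (forall i, i \in K -> s i = s' i) -> A s =1 A s') ->
  (forall s, \sum_(v | A s v) p v <= q) ->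
  sample_prob (fun s => [forall i, (i \notin K) ==> A s (s i)]) <= q ^+ #|~: K|.
Proof.
move=> A_local A_le.
pose restr (s : {ffun J -> F}) := [ffun i => if i \in K then Some (s i) else None].
have restrP (s s' : {ffun J -> F}) :
    reflect (forall i, i \in K -> s i = s' i) (restr s == restr s').
  apply: (iffP eqP) => [/ffunP rs i iK|ss']; last first.
    by apply/ffunP => i; rewrite !ffunE; case: ifP => // /ss' ->.
  by have := rs i; rewrite !ffunE iK => -[].
have restr_cylinder B (t s : {ffun J -> F}) :
    [forall i, (i \notin K) ==> B (s i)] && (restr s == restr t) = cylinder K t B s.
  apply/andP/forallP => [[/forallP sB /restrP st] i|st].
    by case: ifP (sB i) => [/st ->|].
  split; last by apply/restrP => i iK; have := st i; rewrite iK => /eqP.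
  by apply/forallP => i; apply/implyP => iK; have := st i; rewrite (negPf iK).
rewrite -[leRHS]mulr1 -sample_probT /sample_prob (partition_big restr predT) //=.
rewrite [X in _ <= _ * X](partition_big restr predT) //= mulr_sumr; apply: ler_sum => u _.
have [[t <-]|no_t] := pselect (exists t, restr t = u); last first.
  have no_s s : (restr s == u) = false by apply/eqP => su; apply: no_t; exists s.
  by rewrite !big_pred0 ?mulr0 // => s; rewrite no_s ?andbF.
have conditional_cylinder s :
    [forall i, (i \notin K) ==> A s (s i)] && (restr s == restr t) = cylinder K t (A t) s.
  rewrite -restr_cylinder; case: restrP => [st|_]; last by rewrite !andbF.
  by congr (_ && _); apply: eq_forallb => i; rewrite (A_local s t).
have restr_cylinderT s : (restr s == restr t) = cylinder K t predT s.
  rewrite -restr_cylinder; case: eqP; rewrite ?andbF // andbT.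
  by symmetry; apply/forallP => i; rewrite implybT.
rewrite (eq_bigl _ _ conditional_cylinder) (eq_bigl _ _ restr_cylinderT).
rewrite -!/(sample_prob _) !sample_prob_cylinder p_sum1 expr1n mul1r.
by rewrite ler_wpM2r ?prodr_ge0 // lerXn2r ?nnegrE ?sumr_ge0 // (le_trans _ (A_le t)) ?sumr_ge0.
Qed.

Lemma card_preim_blocks_ge (B : finType) (blk : J -> B) (K : {set B}) (m : nat) :
  (forall b, (m <= #|[set i | blk i == b]%SET|)%N) -> (m * #|K| <= #|blk @^-1: K|)%N.
Proof.
move=> blk_ge; rewrite -[in leqRHS]sum1_card (partition_big blk (mem K)) /=; last first.
  by move=> i; rewrite inE.
rewrite mulnC -sum_nat_const; apply: leq_sum => b bK.
apply: leq_trans (blk_ge b) _; rewrite -sum1_card; apply: eq_leq; apply: eq_bigl => i.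
by rewrite !inE; case: eqP => [->|]; rewrite ?bK ?andbF.
Qed.

Lemma sample_compression_le (B : finType) (blk : J -> B) (A : {set J} -> {ffun J -> F} -> pred F)
    (m d : nat) (q : R) :
  (forall (K : {set J}) (s s' : {ffun J -> F}),
     (forall i, i \in K -> s i = s' i) -> A K s =1 A K s') ->
  (forall K s, \sum_(v | A K s v) p v <= q) -> 0 <= q <= 1 ->
  (forall b, (m <= #|[set i | blk i == b]%SET|)%N) ->
  sample_prob (fun s => [exists K : {set B}, (#|K| <= d)%N &&
    [forall i, (blk i \notin K) ==> A (blk @^-1: K) s (s i)]]) <= 2 ^+ #|B| * q ^+ (m * (#|B| - d)).
Proof.
move=> A_local A_le /andP[q0 q1] blk_ge.
pose E (K : {set B}) (s : {ffun J -> F}) :=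
  [forall i, (i \notin blk @^-1: K) ==> A (blk @^-1: K) s (s i)].
have union := @sample_prob_union_bound _ (fun K : {set B} => #|K| <= d)%N _ E.
apply: le_trans (union _ _) _ => [s /existsP[K /andP[Kd /forallP sK]]|].
  by exists K => //; apply/forallP => i; rewrite inE.
have E_le (K : {set B}) : (#|K| <= d)%N -> sample_prob (E K) <= q ^+ (m * (#|B| - d)).
  move=> Kd; apply: le_trans (sample_prob_conditional_le (A_local _) (A_le _)) _.
  rewrite -preimsetC ler_wiXn2l //; apply: leq_trans (card_preim_blocks_ge (~: K) blk_ge).
  by rewrite leq_mul2l cardsCs finset.setCK leq_sub2l ?orbT.
apply: le_trans (ler_sum _ E_le) _.
rewrite sumr_const -[leLHS]mulr_natl -natrX ler_wpM2r ?exprn_ge0 // ler_nat.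
by rewrite -[#|B|]cardsT -card_powerset powersetT subset_leq_card // subsetT.
Qed.

End FiniteSampling.

Section SampleHull.
Variable R : realType.

Definition hull_meets_ball (J I : finType) (z : J -> I -> R) (eps : R) : Prop :=
  exists2 w, simplex w & dot (comb w z) (comb w z) <= eps ^+ 2.

Definition beyond_nearest (J I F : finType) (y : F -> I -> R) (eps : R) (K : {set J})
    (s : {ffun J -> F}) : pred F :=
  fun v => `[< exists p, [/\ nearest_in_hull (y \o s) K p, 0 < dot p p &
    eps * Num.sqrt (dot p p) < dot p (y v)] >].

Lemma beyond_nearest_local (J I F : finType) (y : F -> I -> R) eps (K : {set J})
    (s s' : {ffun J -> F}) :
  (forall i, i \in K -> s i = s' i) -> beyond_nearest y eps K s =1 beyond_nearest y eps K s'.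
Proof.
have imp (t t' : {ffun J -> F}) v : (forall i, i \in K -> t i = t' i) ->
    beyond_nearest y eps K t v -> beyond_nearest y eps K t' v.
  move=> tt' /asboolP[p [pK p0 pv]]; apply/asboolP; exists p; split=> //.
  by apply: eq_nearest_in_hull pK => i iK; rewrite /= tt'.
by move=> ss' v; apply/idP/idP; apply: imp => // i /ss'.
Qed.

Lemma beyond_nearest_prob_le (J I F : finType) (p : F -> R) (y : F -> I -> R) eps q :
  0 <= q ->
  (forall c, 0 < dot c c -> \sum_(v | eps * Num.sqrt (dot c c) < dot c (y v)) p v <= q) ->
  forall (K : {set J}) s, \sum_(v | beyond_nearest y eps K s v) p v <= q.
Proof.
move=> q0 cap_le K s.
have [[c [cK c0]]|no_c] :=
  pselect (exists c, nearest_in_hull (y \o s) K c /\ 0 < dot c c); last first.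
  by rewrite big_pred0 // => v; apply/asboolP => -[c [cK c0 _]]; apply: no_c; exists c.
rewrite (eq_bigl (fun v => eps * Num.sqrt (dot c c) < dot c (y v))) ?cap_le // => v.
apply/asboolP/idP => [[c' [c'K _]]|cv]; last by exists c.
by rewrite (nearest_in_hull_uniq c'K cK).
Qed.

Lemma hull_misses_ball_beyond (J I F B : finType) (y : F -> I -> R) (eps : R) (blk : J -> B)
    (s : {ffun J -> F}) : (0 < #|J|)%N -> 0 <= eps -> ~ hull_meets_ball (y \o s) eps ->
  exists2 K : {set B}, (#|K| <= #|I|)%N &
    forall i, blk i \notin K -> beyond_nearest y eps (blk @^-1: K) s (s i).
Proof.
move=> J0 eps0 miss; have [p pP] := nearest_in_hull_exists (y \o s) J0.
have eps_p : eps ^+ 2 < dot p p.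
  have [[w [ws _ pw]] _] := pP; rewrite ltNge; apply/negP => p_le.
  by apply: miss; exists w; rewrite -?pw.
have p0 : 0 < dot p p := le_lt_trans (sqr_ge0 eps) eps_p.
have [S SI pS] := nearest_in_hull_caratheodory pP p0.
exists (blk @: S); first exact: leq_trans (leq_imset_card _ _) SI.
move=> i _; apply/asboolP; exists p; split=> //.
  by apply/pS/fintype.subsetP => l lS; rewrite inE imset_f.
have [_ /(_ i)] := pP; rewrite inE => /(_ isT); apply: lt_le_trans.
rewrite -[ltRHS]sqr_sqrtr ?(ltW p0) // expr2 ltr_pM2r ?sqrtr_gt0 //.
by rewrite -(ltr_pXn2r (ltn0Sn 1)) ?nnegrE ?sqrtr_ge0 // sqr_sqrtr // ltW.
Qed.

Lemma card_modn_fiber_ge (N M m : nat) (b : 'I_M) : (m * M <= N)%N ->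
  (m <= #|[set i : 'I_N | i %% M == b]%SET|)%N.
Proof.
move=> mMN; have M0 : (0 < M)%N by exact: leq_ltn_trans (ltn_ord b).
have lt_N (t : 'I_m) : (b + t * M < N)%N.
  apply: leq_trans mMN; apply: (@leq_trans (t.+1 * M)); last by rewrite leq_mul2r ltn_ord orbT.
  by rewrite mulSn ltn_add2r.
rewrite -[m in leqLHS]card_ord -(card_imset _ (_ : injective (fun t => Ordinal (lt_N t)))).
  apply/subset_leq_card/fintype.subsetP => _ /imsetP[t _ ->].
  by rewrite inE /= addnC modnMDl modn_small.
move=> t t' /(congr1 val) /= /eqP; rewrite eqn_add2l eqn_pmul2r // => /eqP; exact: val_inj.
Qed.

(* With [2D] blocks of at least [3n] sample points, there are [4 ^ D] unions of blocks. *)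
Lemma hull_misses_ball_prob_le (I F : finType) (N n : nat) (p : F -> R) (y : F -> I -> R)
    (eps q : R) :
  (forall v, 0 <= p v) -> \sum_v p v = 1 ->
  (0 < #|I|)%N -> (0 < N)%N -> (6 * #|I| * n <= N)%N ->
  0 <= eps -> 0 <= q <= 1 -> q ^+ n <= 2^-1 ->
  (forall c, 0 < dot c c -> \sum_(v | eps * Num.sqrt (dot c c) < dot c (y v)) p v <= q) ->
  sample_prob p (fun s : {ffun 'I_N -> F} => ~~ `[< hull_meets_ball (y \o s) eps >]) <= 2 ^- #|I|.
Proof.
move=> p_ge0 p_sum1 I0 N0 nN eps0 q01 qn cap_le; set D := #|I| in I0 nN *.
have D2 : (0 < 2 * D)%N by rewrite muln_gt0.
pose blk (i : 'I_N) : 'I_(2 * D) := Ordinal (ltn_pmod i D2).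
have blk_ge b : (3 * n <= #|[set i | blk i == b]%SET|)%N.
  apply: card_modn_fiber_ge; apply: leq_trans nN.
  by rewrite leq_eqVlt; apply/orP; left; apply/eqP; ring.
have [q0 q1] := andP q01.
have miss_compressed (s : {ffun 'I_N -> F}) : ~~ `[< hull_meets_ball (y \o s) eps >] ->
    [exists K : {set 'I_(2 * D)}, (#|K| <= D)%N &&
      [forall i, (blk i \notin K) ==> beyond_nearest y eps (blk @^-1: K) s (s i)]].
  move=> /asboolPn miss; have J0 : (0 < #|'I_N|)%N by rewrite card_ord.
  have [K KD sK] := hull_misses_ball_beyond blk J0 eps0 miss.
  by apply/existsP; exists K; rewrite KD; apply/forallP => i; apply/implyP/sK.
apply: le_trans (sample_prob_mono p_ge0 miss_compressed) _.
apply: le_trans (sample_compression_le p_ge0 p_sum1 _ (@beyond_nearest_local _ _ _ y eps)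
  (beyond_nearest_prob_le q0 cap_le) q01 blk_ge) _.
rewrite card_ord (_ : 2 * D - D = D)%N; last by rewrite mul2n -addnn addnK.
have -> : (3 * n * D = n * (2 * D + D))%N by ring.
rewrite [q ^+ _]exprM; apply: (@le_trans _ _ (2 ^+ (2 * D) * 2^-1 ^+ (2 * D + D))).
  by rewrite ler_wpM2l ?exprn_ge0 // lerXn2r ?nnegrE ?exprn_ge0.
by rewrite exprD mulrA -exprMn divff ?expr1n ?mul1r ?exprVn.
Qed.

End SampleHull.

Section ProbabilityIntegrals.
Variables (R : realType) (d : measure_display) (T : measurableType d) (mu : probability T R).
Implicit Types f g : T -> R.

Lemma bounded_integrable f (c : R) :
  measurable_fun setT f -> (forall x, `|f x| <= c) -> mu.-integrable setT (EFin \o f).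
Proof.
move=> mf fc; apply: measurable_bounded_integrable => //.
  by rewrite ltey_eq fin_num_measure.
by exists c; split=> [|M cM x _ /=]; [exact: num_real|exact: le_trans (fc x) (ltW cM)].
Qed.

Lemma cst_integrable (c : R) : mu.-integrable setT (EFin \o (fun=> c)).
Proof. exact: (finite_measure_integrable_cst _ _ measurableT). Qed.

Lemma Rintegral_probability_cst (c : R) : \int[mu]_x c = c.
Proof.
transitivity (c * fine (mu setT)); first exact: (Rintegral_cst mu measurableT c).
by rewrite probability_setT mulr1.
Qed.

Section Sums.
Variables (I : Type) (r : seq I) (f : I -> T -> R).
Hypothesis f_integrable : forall i, mu.-integrable setT (EFin \o f i).

Lemma integrable_sumr : mu.-integrable setT (EFin \o (fun x => \sum_(i <- r) f i x)).
Proof.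
rewrite [_ \o _](_ : _ = fun x => (\sum_(i <- r) (EFin \o f i) x)%E).
  by apply: integrable_sum => // i _; exact: f_integrable.
by apply/funext => x; rewrite /= -sumEFin.
Qed.

Lemma Rintegral_sumr : \int[mu]_x (\sum_(i <- r) f i x) = \sum_(i <- r) \int[mu]_x f i x.
Proof.
rewrite /Rintegral; under eq_integral do rewrite -sumEFin.
rewrite integral_sum // sum_fine // => i _.
exact: (integrable_fin_num measurableT (f_integrable i)).
Qed.

End Sums.

Lemma Rintegral_dot (J : finType) (c : J -> R) (f : J -> T -> R) :
  (forall i, mu.-integrable setT (EFin \o f i)) ->
  \int[mu]_x dot c (f^~ x) = dot c (fun i => \int[mu]_x f i x).
Proof.
move=> fi; rewrite Rintegral_sumr => [|i]; last exact: (integrableZl measurableT _ (fi i)).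
by apply: eq_bigr => i _; rewrite RintegralZl.
Qed.

Lemma Rintegral_norm_le f (c : R) :
  measurable_fun setT f -> (forall x, `|f x| <= c) -> `|\int[mu]_x f x| <= c.
Proof.
move=> mf fc; have fi := bounded_integrable mf fc.
have fc' x : - c <= f x <= c by rewrite -ler_norml.
rewrite ler_norml -[X in X <= _ <= _]Rintegral_probability_cst.
rewrite -[X in _ <= _ <= X]Rintegral_probability_cst.
by apply/andP; split; apply: le_Rintegral => //; try exact: cst_integrable;
  move=> x _; case/andP: (fc' x).
Qed.

Lemma Rintegral_sq_le f : mu.-integrable setT (EFin \o f) ->
  mu.-integrable setT (EFin \o (fun x => f x ^+ 2)) ->
  (\int[mu]_x f x) ^+ 2 <= \int[mu]_x (f x ^+ 2).
Proof.
move=> fi f2i; set m := \int[mu]_x f x.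
have lin_i : mu.-integrable setT (EFin \o (fun x => - (2 * m) * f x)).
  exact: (integrableZl measurableT _ fi).
have var_ge0 : 0 <= \int[mu]_x ((f x ^+ 2 + - (2 * m) * f x) + m ^+ 2).
  apply: Rintegral_ge0 => x _.
  by rewrite (_ : _ + _ = (f x - m) ^+ 2) ?sqr_ge0 //; ring.
have sum_i := integrableD measurableT f2i lin_i.
move: var_ge0; rewrite (RintegralD measurableT sum_i (cst_integrable _)).
rewrite (RintegralD measurableT f2i lin_i) (RintegralZl _ measurableT fi) -/m.
rewrite Rintegral_probability_cst; lra.
Qed.

Lemma dominated_cvg_Rintegral (f_ : nat -> T -> R) f (c : R) :
  (forall n, measurable_fun setT (f_ n)) -> (forall n x, `|f_ n x| <= c) ->
  (forall x, (fun n => f_ n x) @ \oo --> f x) ->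
  (fun n => \int[mu]_x f_ n x) @ \oo --> \int[mu]_x f x.
Proof.
move=> mf fc ff; have mf' : measurable_fun setT f.
  by apply: measurable_fun_cvg mf _ => x _; exact: ff.
have fc' x : `|f x| <= c.
  by apply: (cvgr_to_le (cvg_norm (ff x))); exact: nearW.
apply: fine_cvg; rewrite fineK; last first.
  exact: (integrable_fin_num measurableT (bounded_integrable mf' fc')).
apply: (@dominated_cvg _ _ _ mu setT measurableT _ _ (EFin \o cst c)) => //.
- by move=> n; exact/measurable_EFinP.
- by move=> x _; apply: cvg_EFin; [exact: nearW|exact: ff].
- exact: cst_integrable.
- by move=> n x _ /=; rewrite lee_fin.
Qed.

End ProbabilityIntegrals.

Section FiniteValuedMaps.
Variables (R : realType) (dT : measure_display) (T : measurableType dT) (P : probability T R).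
Variables (F : finType) (c : T -> F).
Hypothesis c_measurable : forall v, measurable (c @^-1` [set v]).

Lemma finite_preimageE (Q : pred F) : [set t | Q (c t)] = \bigcup_(v in [set` Q]) c @^-1` [set v].
Proof. by apply/seteqP; split=> [t Qt|t [v Qv /= ->]] //; exists (c t). Qed.

Lemma finite_preimage_measurable (Q : pred F) : measurable [set t | Q (c t)].
Proof. by rewrite finite_preimageE; apply: fin_bigcup_measurable. Qed.

Lemma finite_preimage_prob (Q : pred F) :
  fine (P [set t | Q (c t)]) = \sum_(v | Q v) fine (P (c @^-1` [set v])).
Proof.
have disjoint : trivIset [set` Q] (fun v => c @^-1` [set v]).
  by move=> v v' _ _ [t [/= <- <-]].
rewrite finite_preimageE -fsbig_setU // measure_fsbig //.
rewrite -(@bigfs _ _ _ _ (index_enum F)) ?index_enum_uniq // => [|v _]; last first.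
  by rewrite mem_index_enum.
by rewrite -sum_fine // => v _; exact: fin_num_measure.
Qed.

Lemma finite_preimage_prob_sum1 : \sum_v fine (P (c @^-1` [set v])) = 1.
Proof.
rewrite -(finite_preimage_prob xpredT) (_ : [set t | _] = setT) ?probability_setT //.
by apply/seteqP.
Qed.

End FiniteValuedMaps.

Section IndependentSample.
Variables (R : realType) (dX dO : measure_display) (X : measurableType dX).
Variables (Omega : measurableType dO) (mu : probability X R) (P : probability Omega R).
Variables (N : nat) (Xs : 'I_N -> Omega -> X) (F : finType) (c : X -> F).
Hypotheses (iid : iid_with_law P mu Xs) (c_measurable : forall v, measurable (c @^-1` [set v])).

Definition sample_of (om : Omega) : {ffun 'I_N -> F} := [ffun i => c (Xs i om)].

Lemma sample_of_preimage (s : {ffun 'I_N -> F}) :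
  sample_of @^-1` [set s] = [set om | forall i : 'I_N, (c @^-1` [set s i]) (Xs i om)].
Proof.
apply/seteqP; split=> om /=; first by move=> <- i; rewrite ffunE.
by move=> cs; apply/ffunP => i; rewrite ffunE.
Qed.

Lemma sample_of_measurable (s : {ffun 'I_N -> F}) : measurable (sample_of @^-1` [set s]).
Proof.
rewrite sample_of_preimage (_ : [set om | _] =
    \bigcap_(i in [set: 'I_N]) (setT `&` Xs i @^-1` (c @^-1` [set s i]))).
  by apply: fin_bigcap_measurable => // i _; apply: (proj1 iid i).
by apply/seteqP; split=> om /= Xs_in i; [move=> _; split=> //; exact: Xs_in|case: (Xs_in i I)].
Qed.

Lemma iid_sample_prob (Q : pred {ffun 'I_N -> F}) :
  fine (P [set om | Q (sample_of om)]) =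
  sample_prob (fun v => fine (mu (c @^-1` [set v]))) Q.
Proof.
rewrite (finite_preimage_prob P sample_of_measurable); apply: eq_bigr => s _.
have [_ law] := iid; rewrite sample_of_preimage (law (fun i => c @^-1` [set s i])) //.
rewrite (eq_bigr (fun i => (fine (mu (c @^-1` [set s i])))%:E)) ?prodEFin // => i _.
by rewrite fineK // fin_num_measure.
Qed.

End IndependentSample.

Section UpperTail.
Variables (R : realType) (dT : measure_display) (T : measurableType dT) (mu : probability T R).

Lemma measurable_set_ler (f g : T -> R) :
  measurable_fun setT f -> measurable_fun setT g -> measurable [set x | f x <= g x].
Proof.
move=> mf mg; rewrite -[X in measurable X]setTI.
exact: (measurable_fun_ler mf mg measurableT (I : measurable [set true])).
Qed.

Lemma measurable_set_ltr (f g : T -> R) :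
  measurable_fun setT f -> measurable_fun setT g -> measurable [set x | f x < g x].
Proof.
move=> mf mg; rewrite -[X in measurable X]setTI.
exact: (measurable_fun_ltr mf mg measurableT (I : measurable [set true])).
Qed.

Lemma fine_probability_le (A B : set T) : measurable A -> measurable B -> A `<=` B ->
  fine (mu A) <= fine (mu B).
Proof. by move=> mA mB AB; rewrite fine_le ?fin_num_measure // le_measure ?inE. Qed.

Lemma Rintegral_markov (g : T -> R) (a : R) : 0 < a -> (forall x, 0 <= g x) ->
  mu.-integrable setT (EFin \o g) -> a * fine (mu [set x | a <= g x]) <= \int[mu]_x g x.
Proof.
move=> a0 g0 gi; have mg : measurable_fun setT (EFin \o g) by case/integrableP: gi.
have := le_integral_abse mu measurableT mg a0; rewrite setTI.
rewrite (_ : [set x | _] = [set x | a <= g x]); last first.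
  by apply/seteqP; split=> x /=; rewrite lee_fin ger0_norm.
rewrite (eq_integral (EFin \o g)) => [|x _ /=]; last by rewrite ger0_norm.
have ma : measurable [set x | a <= g x].
  by apply: measurable_set_ler => //; exact/measurable_EFinP.
rewrite -[X in (_ * X)%E]fineK ?fin_num_measure // -EFinM -lee_fin /Rintegral.
by rewrite fineK ?integrable_fin_num.
Qed.

(* Markov's inequality for the nonnegative function [g x - \int[mu]_x g x + 2 * a]. *)
Lemma upper_tail_le (g : T -> R) (a : R) (n : nat) : measurable_fun setT g ->
  (forall x, `|g x| <= a) -> 0 < a -> (0 < n)%N ->
  fine (mu [set x | 2 * a / n%:R < g x - \int[mu]_x g x]) <= n%:R / n.+1%:R.
Proof.
move=> mg ga a0 n0; set m := \int[mu]_x g x.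
have nR : 0 < n%:R :> R by rewrite ltr0n.
have gi := bounded_integrable mu mg ga.
pose shifted x := g x + (2 * a - m).
have shifted_ge0 x : 0 <= shifted x.
  have := Rintegral_norm_le mu mg ga; have := ga x.
  by rewrite -/m /shifted !ler_norml => /andP[+ _] /andP[_ +]; lra.
have shifted_integrable := integrableD measurableT gi (cst_integrable mu (2 * a - m)).
have shifted_mean : \int[mu]_x shifted x = 2 * a.
  rewrite RintegralD ?Rintegral_probability_cst -/m //; first ring.
  exact: cst_integrable.
have level_gt0 : 0 < 2 * a * (n.+1%:R / n%:R).
  by rewrite !mulr_gt0 ?invr_gt0 ?ltr0n.
have := Rintegral_markov level_gt0 shifted_ge0 shifted_integrable.
rewrite shifted_mean -mulrA -[leRHS]mulr1 ler_pM2l ?mulr_gt0 // => tail_le.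
apply: (@le_trans _ _ (fine (mu [set x | 2 * a * (n.+1%:R / n%:R) <= shifted x]))).
  have shifted_measurable : measurable_fun setT shifted by exact: measurable_funD.
  apply: fine_probability_le => [||x /=].
  - by apply: measurable_set_ltr => //; exact: measurable_funB.
  - exact: measurable_set_ler.
  - have -> : 2 * a * (n.+1%:R / n%:R) = 2 * a + 2 * a / n%:R.
      by rewrite -[n.+1%:R]natr1; field; rewrite gt_eqF.
    by rewrite /shifted; lra.
by rewrite -[leRHS]invf_div -[leRHS]mul1r ler_pdivlMr ?divr_gt0 ?ltr0n // mulrC.
Qed.

End UpperTail.

Section Rounding.
Variables (R : realType) (dT : measure_display) (T : measurableType dT).

Lemma exists_bounded_grid (kap eta : R) : 0 < eta ->
  exists (L : nat) (r : 'I_L.+1 -> R), forall g : T -> R,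
    measurable_fun setT g -> (forall x, `|g x| <= kap) ->
    exists c : T -> 'I_L.+1, (forall v, measurable (c @^-1` [set v])) /\
      forall x, `|g x - r (c x)| <= eta.
Proof.
move=> eta0; exists (Num.truncn (2 * kap / eta)), (fun v => (v : nat)%:R * eta - kap) => g mg g_le.
pose y x := (g x + kap) / eta.
have g_itv x : - kap <= g x <= kap by rewrite -ler_norml.
have y0 x : 0 <= y x by rewrite divr_ge0 ?(ltW eta0) //; case/andP: (g_itv x); lra.
have yL x : (Num.truncn (y x) < (Num.truncn (2 * kap / eta)).+1)%N.
  rewrite ltnS; apply: le_truncn; rewrite ler_wpM2r ?invr_ge0 ?(ltW eta0) //.
  by case/andP: (g_itv x); lra.
exists (fun x => Ordinal (yL x)); split=> [v|x /=].
  have -> : (fun x => Ordinal (yL x)) @^-1` [set v] = y @^-1` `[(v : nat)%:R, v.+1%:R[.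
    apply/seteqP; split=> x /=; rewrite in_itv /=; first by move=> <-; exact: truncn_itv.
    by move=> vx; apply: val_inj; exact: truncn_def.
  rewrite -[X in measurable X]setTI; apply: measurable_funM => //; exact: measurable_funD.
have -> : g x - ((Num.truncn (y x))%:R * eta - kap) = (y x - (Num.truncn (y x))%:R) * eta.
  by rewrite /y; field; rewrite gt_eqF.
have /andP[trunc_le lt_trunc] := truncn_itv (y0 x).
rewrite normrM (ger0_norm (ltW eta0)) ger0_norm ?subr_ge0 // ler_piMl ?(ltW eta0) //.
by rewrite lerBlDl natr1 ltW.
Qed.

Lemma finite_rounding (I : finType) (psi : T -> I -> R) (kap delta : R) :
  (forall j, measurable_fun setT (psi^~ j)) -> (forall x j, `|psi x j| <= kap) -> 0 < delta ->
  exists (F : finType) (cell : T -> F) (rep : F -> I -> R),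
    (forall v, measurable (cell @^-1` [set v])) /\
    forall x, sqdist (@dot R I) (psi x) (rep (cell x)) <= delta ^+ 2.
Proof.
move=> mpsi psi_le delta0; pose eta := delta / #|I|.+1%:R.
have eta0 : 0 < eta by rewrite divr_gt0.
have [L [r grid]] := exists_bounded_grid kap eta0.
have [c cP] := choice (fun j => grid _ (mpsi j) (psi_le^~ j)).
exists ({ffun I -> 'I_L.+1} : finType), (fun x => [ffun j => c j x]),
  (fun (v : {ffun I -> 'I_L.+1}) j => r (v j)).
split=> [v|x].
  have -> : (fun x => [ffun j => c j x]) @^-1` [set v] =
      \bigcap_(j in [set: I]) (c j @^-1` [set v j]).
    apply/seteqP; split=> x /=; first by move=> <- j _; rewrite ffunE.
    by move=> vx; apply/ffunP => j; rewrite ffunE; exact: vx.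
  by apply: fin_bigcap_measurable => // j _; exact: (cP j).1.
apply: (@le_trans _ _ (\sum_(j : I) eta ^+ 2)).
  apply: ler_sum => j _; rewrite -expr2 ffunE -real_normK ?num_real //.
  by rewrite lerXn2r ?nnegrE ?(ltW eta0) // (cP j).2.
rewrite sumr_const -mulr_natr /eta expr_div_n -mulrA ler_piMr ?sqr_ge0 //.
rewrite mulrC ler_pdivrMr ?exprn_gt0 // mul1r -natrX ler_nat.
by rewrite (leq_trans (leqnSn _)) // -mulnn leq_pmulr.
Qed.

End Rounding.

Lemma bernoulli_inequality (R : realDomainType) (x : R) (n : nat) :
  0 <= x -> 1 + n%:R * x <= (1 + x) ^+ n.
Proof.
move=> x0; elim: n => [|n IH]; first by rewrite mul0r addr0 expr0.
have x1 : 0 <= 1 + x by rewrite addr_ge0.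
rewrite exprS; apply: le_trans (ler_wpM2l x1 IH).
have : 0 <= n%:R * x ^+ 2 by rewrite mulr_ge0 ?ler0n ?sqr_ge0.
by rewrite -natr1; move: (n%:R) => m; lra.
Qed.

Lemma ratio_succ_exp_le_half (R : realFieldType) (n : nat) : (0 < n)%N ->
  (n%:R / n.+1%:R) ^+ n <= 2^-1 :> R.
Proof.
move=> n0; have nR : 0 < n%:R :> R by rewrite ltr0n.
have -> : n%:R / n.+1%:R = (1 + n%:R^-1)^-1 :> R by rewrite -[n.+1%:R]natr1; field; lra.
rewrite exprVn lef_pV2 ?posrE ?exprn_gt0 ?addr_gt0 ?invr_gt0 //.
apply: le_trans (bernoulli_inequality n (_ : 0 <= n%:R^-1)); last by rewrite invr_ge0 ltW.
by rewrite mulfV ?gt_eqF.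
Qed.

Lemma sqdist_comb_le (R : realFieldType) (J I : finType) (w : J -> R) (z z' : J -> I -> R)
    (m : I -> R) (eps delta : R) : 0 <= eps -> 0 <= delta -> simplex w ->
  (forall i, sqdist (@dot R I) (z i) (z' i) <= delta ^+ 2) ->
  dot (comb w (fun i j => z' i j - m j)) (comb w (fun i j => z' i j - m j)) <= eps ^+ 2 ->
  sqdist (@dot R I) (comb w z) m <= (eps + delta) ^+ 2.
Proof.
move=> eps0 delta0 ws close hull; have sip := dot_sip R I; rewrite /sqdist.
have -> : (fun j => comb w z j - m j) = (fun j =>
    comb w (fun i j => z' i j - m j) j + comb w (fun i j => z i j - z' i j) j).
  by apply/funext => j; rewrite /comb !dotBr (dot_simplex_cst ws); ring.
apply: (sip_add_self_le sip) => //; rewrite -[delta](dot_simplex_cst ws).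
exact: (sip_comb_self_le sip).
Qed.

Section HullOfIidSample.
Variables (R : realType) (dX dO : measure_display) (X : measurableType dX).
Variables (Omega : measurableType dO) (mu : probability X R) (P : probability Omega R).
Variables (I : finType) (psi : X -> I -> R) (kap : R).
Hypothesis psi_measurable : forall j, measurable_fun setT (psi^~ j).
Hypotheses (kap_ge0 : 0 <= kap) (psi_le : forall x, dot (psi x) (psi x) <= kap ^+ 2).

Definition vec_mean : I -> R := fun j => \int[mu]_x psi x j.

Lemma psi_norm_le x j : `|psi x j| <= kap.
Proof.
rewrite -(ler_pXn2r (ltn0Sn 1)) ?nnegrE // real_normK ?num_real //.
apply: le_trans (psi_le x); rewrite /dot (bigD1 j) //= -expr2 lerDl.
by apply: sumr_ge0 => i _; rewrite -expr2 sqr_ge0.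
Qed.

Lemma psi_integrable j : mu.-integrable setT (EFin \o psi^~ j).
Proof. exact: (bounded_integrable mu (psi_measurable j) (psi_norm_le^~ j)). Qed.

Lemma dot_psi_measurable c : measurable_fun setT (fun x => dot c (psi x)).
Proof. by apply: measurable_sum => j; exact: measurable_funM. Qed.

Lemma dot_psi_norm_le c x : `|dot c (psi x)| <= Num.sqrt (dot c c) * kap.
Proof.
by apply: (cauchy_schwarz_le (dot_sip R I)); rewrite ?sqrtr_ge0 ?sqr_sqrtr ?dot_self_ge0.
Qed.

Lemma halfspace_prob_le c n : (0 < n)%N -> 0 < kap -> 0 < dot c c ->
  fine (mu [set x | 2 * kap / n%:R * Num.sqrt (dot c c) < dot c (psi x) - dot c vec_mean])
    <= n%:R / n.+1%:R.
Proof.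
move=> n0 kap0 c0; have c_kap0 : 0 < Num.sqrt (dot c c) * kap by rewrite mulr_gt0 ?sqrtr_gt0.
have := upper_tail_le mu (dot_psi_measurable c) (dot_psi_norm_le c) c_kap0 n0.
rewrite (Rintegral_dot _ psi_integrable).
rewrite (_ : 2 * (_ * _) / _ = 2 * kap / n%:R * Num.sqrt (dot c c)) //.
by rewrite (mulrC _ kap) mulrA mulrAC.
Qed.

Lemma rounded_halfspace_prob_le (F : finType) (cell : X -> F) (rep : F -> I -> R) c n :
  (forall v, measurable (cell @^-1` [set v])) ->
  (forall x, sqdist (@dot R I) (psi x) (rep (cell x)) <= (kap / n%:R) ^+ 2) ->
  (0 < n)%N -> 0 < kap -> 0 < dot c c ->
  \sum_(v | 3 * kap / n%:R * Num.sqrt (dot c c) < dot c (fun j => rep v j - vec_mean j))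
    fine (mu (cell @^-1` [set v])) <= n%:R / n.+1%:R.
Proof.
move=> mcell close n0 kap0 c0; rewrite -finite_preimage_prob //.
pose cap v := 3 * kap / n%:R * Num.sqrt (dot c c) < dot c (fun j => rep v j - vec_mean j).
apply: le_trans (halfspace_prob_le n0 kap0 c0).
apply: fine_probability_le => [||x /=].
- exact: (finite_preimage_measurable mcell cap).
- by apply: measurable_set_ltr => //; apply: measurable_funB => //; exact: dot_psi_measurable.
have : `|dot c (fun j => psi x j - rep (cell x) j)| <= Num.sqrt (dot c c) * (kap / n%:R).
  apply: (cauchy_schwarz_le (dot_sip R I)) => //;
    rewrite ?sqrtr_ge0 ?divr_ge0 ?sqr_sqrtr ?dot_self_ge0 //.
  exact: close.
rewrite !dotBr ler_norml -!mulrA (mulrC (Num.sqrt _)) => /andP[+ _]; lra.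
Qed.

Lemma iid_hull_near_mean_of_pos (N n : nat) (Xs : 'I_N -> Omega -> X) : iid_with_law P mu Xs ->
  (0 < #|I|)%N -> (0 < n)%N -> (6 * #|I| * n <= N)%N -> 0 < kap ->
  exists E : set Omega, [/\ measurable E, ((1 - 2 ^- #|I|)%:E <= P E)%E &
    forall om, E om -> exists2 w, simplex w &
      sqdist (@dot R I) (comb w (fun i => psi (Xs i om))) vec_mean <= (4 * kap / n%:R) ^+ 2].
Proof.
move=> iid I0 n0 nN kap0; have N0 : (0 < N)%N by apply: leq_trans nN; rewrite !muln_gt0 I0.
have delta0 : 0 < kap / n%:R by rewrite divr_gt0 ?ltr0n.
have [F [cell [rep [mcell close]]]] := finite_rounding psi_measurable psi_norm_le delta0.
pose y v j := rep v j - vec_mean j; pose eps := 3 * kap / n%:R.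
have eps0 : 0 <= eps by rewrite divr_ge0 ?mulr_ge0.
pose Q (s : {ffun 'I_N -> F}) := `[< hull_meets_ball (y \o s) eps >].
have mE := finite_preimage_measurable (sample_of_measurable iid mcell) Q.
exists [set om | Q (sample_of Xs cell om)]; split=> //.
  rewrite -[X in (_ <= X)%E]fineK ?fin_num_measure // lee_fin (iid_sample_prob iid mcell).
  have sum1 := finite_preimage_prob_sum1 mu mcell.
  rewrite (sample_probC sum1) lerD2l lerN2.
  apply: (hull_misses_ball_prob_le _ sum1 I0 N0 nN eps0 _ (ratio_succ_exp_le_half R n0)) => [v||c].
  - exact/fine_ge0/measure_ge0.
  - by rewrite divr_ge0 // ler_pdivrMr ?ltr0n // mul1r ler_nat leqnSn.
  - exact: (rounded_halfspace_prob_le mcell close n0 kap0).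
move=> om /asboolP[w ws hull]; exists w => //.
have -> : 4 * kap / n%:R = eps + kap / n%:R by rewrite /eps -!mulrA; ring.
apply: (sqdist_comb_le eps0 (ltW delta0) ws (z' := rep \o sample_of Xs cell om)) => [i|].
  by rewrite /= ffunE; exact: close.
exact: hull.
Qed.

Lemma iid_hull_near_mean (N n : nat) (Xs : 'I_N -> Omega -> X) : iid_with_law P mu Xs ->
  (0 < #|I|)%N -> (0 < n)%N -> (6 * #|I| * n <= N)%N ->
  exists E : set Omega, [/\ measurable E, ((1 - 2 ^- #|I|)%:E <= P E)%E &
    forall om, E om -> exists2 w, simplex w &
      sqdist (@dot R I) (comb w (fun i => psi (Xs i om))) vec_mean <= (4 * kap / n%:R) ^+ 2].
Proof.
move=> iid I0 n0 nN; have [kap0|kapN0] := eqVneq kap 0; last first.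
  by apply: (iid_hull_near_mean_of_pos iid); rewrite // lt_def kapN0.
have psi0 x j : psi x j = 0 by have := psi_norm_le x j; rewrite kap0 normr_le0 => /eqP.
have N0 : (0 < N)%N by apply: leq_trans nN; rewrite !muln_gt0 I0.
exists setT; split=> // [|om _].
  by rewrite probability_setT lee_fin gerBl invr_ge0 exprn_ge0.
exists (vertex (Ordinal N0)); first exact: simplex_vertex.
rewrite /sqdist /dot big1 ?sqr_ge0 // => j _.
have -> : vec_mean j = 0.
  by rewrite /vec_mean; under eq_Rintegral do rewrite psi0; rewrite Rintegral_probability_cst.
by rewrite /comb dot_vertexl psi0 subr0 mulr0.
Qed.

End HullOfIidSample.

Section FrankWolfe.
Variables (R : realFieldType) (J : finType) (C b : R) (G : J -> J -> R) (m : J -> R).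

(* The squared distance from a fixed vector to the combination of weights [w], where [C] is the
   squared norm of the vector, [m] its inner products with the atoms, and [G] their Gram matrix. *)
Definition risk (w : J -> R) : R := C - 2 * dot w m + qform G w w.

Definition risk_grad (w : J -> R) : J -> R := fun i => comb w G i - m i.

Hypotheses (G_sym : forall i j, G i j = G j i) (G_psd : forall u, 0 <= qform G u u).
Let G_sip := qform_sip G_sym G_psd.

Lemma risk_along (g : R) (w z : J -> R) :
  risk (fun i => g * z i + w i) = risk w + 2 * g * dot z (risk_grad w) + g ^+ 2 * qform G z z.
Proof.
rewrite /risk dot_linear_l (sip_linear_self G_sip) // dotBr dot_combr.
rewrite (sip_sym G_sip) // /qform; ring.
Qed.

Lemma risk_tangent_le (w v : J -> R) :
  risk w + 2 * dot (fun i => v i - w i) (risk_grad w) <= risk v.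
Proof.
have -> : v = (fun i => 1 * (v i - w i) + w i) by apply/funext => i; rewrite mul1r subrK.
by rewrite risk_along; under [in leLHS]eq_fun do rewrite mul1r addrK; rewrite mulr1 lerDl mulr_ge0.
Qed.

Hypothesis G_le : forall i j, `|G i j| <= b.

Lemma qform_simplex_norm_le (u v : J -> R) : simplex u -> simplex v -> `|qform G u v| <= b.
Proof. by move=> us vs; do 2![apply: dot_simplex_norm_le => // ?]. Qed.

Lemma qform_simplexB_le (u v : J -> R) : simplex u -> simplex v ->
  qform G (fun i => u i - v i) (fun i => u i - v i) <= 4 * b.
Proof.
move=> us vs; rewrite (sipB_self G_sip) //.
have := qform_simplex_norm_le us us; have := qform_simplex_norm_le us vs.
have := qform_simplex_norm_le vs vs; rewrite !ler_norml => /andP[_ +] /andP[+ _] /andP[_ +]; lra.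
Qed.

Lemma frank_wolfe_step (w v : J -> R) (g : R) (i : J) : 0 <= g <= 1 -> simplex w -> simplex v ->
  (forall j, risk_grad w i <= risk_grad w j) ->
  risk (fun j => (1 - g) * w j + g * vertex i j) <=
    (1 - g) * risk w + g * risk v + 4 * b * g ^+ 2.
Proof.
move=> /andP[g0 _] ws vs i_min.
have -> : (fun j => (1 - g) * w j + g * vertex i j) = (fun j => g * (vertex i j - w j) + w j).
  by apply/funext => j; ring.
rewrite risk_along.
have curvature : g ^+ 2 * qform G (fun j => vertex i j - w j) (fun j => vertex i j - w j) <=
    g ^+ 2 * (4 * b).
  by rewrite ler_wpM2l ?sqr_ge0 // qform_simplexB_le //; exact: simplex_vertex.
have descent : risk w + 2 * dot (fun j => vertex i j - w j) (risk_grad w) <= risk v.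
  apply: le_trans (risk_tangent_le w v); rewrite lerD2l ler_pM2l //.
  rewrite !(dotC _ (risk_grad w)) !dotBr lerD2r !(dotC (risk_grad w)) dot_vertexl.
  exact: dot_simplex_ge.
have := ler_wpM2l g0 descent; move: curvature; lra.
Qed.

Hypothesis m_le : forall i, `|m i| <= b.

Lemma risk_vertex_le (i : J) (v : J -> R) : simplex v -> risk (vertex i) <= risk v + 5 * b.
Proof.
move=> vs; have i_simplex : simplex (vertex i : J -> R) := simplex_vertex i.
have := qform_simplex_norm_le i_simplex i_simplex; have := G_psd v.
have := dot_simplex_norm_le i_simplex m_le; have := dot_simplex_norm_le vs m_le.
by rewrite /risk !ler_norml => /andP[_ +] /andP[+ _] + /andP[_ +]; lra.
Qed.

End FrankWolfe.

Section FrankWolfeRun.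
Variables (R : realType) (X : Type) (N : nat) (k : X -> X -> R) (xs : 'I_N -> X).
Variables (m : 'I_N -> R) (W : nat -> 'I_N -> R).

Lemma step_size_itv (t : nat) : 0 <= (2 / (t%:R + 2) : R) <= 1.
Proof.
have t0 : 0 <= t%:R :> R by exact: ler0n.
by rewrite divr_ge0 ?ler_pdivrMr ?mul1r ?lerDr //; lra.
Qed.

Lemma fw_run_simplex (T : nat) : fw_run k xs m W T -> simplex (W T).
Proof.
move=> [[i0 [_ W0]] step]; elim: T step => [_|t IH step].
  by rewrite W0; exact: simplex_vertex.
have [i [_ ->]] := step t (ltnSn t).
apply: simplex_mix (step_size_itv t) (IH _) (simplex_vertex i) => s st.
exact: step s (ltnW st).
Qed.

Variables C b : R.
Let G i j := k (xs i) (xs j).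
Hypotheses (G_sym : forall i j, G i j = G j i) (G_psd : forall u, 0 <= qform G u u).
Hypotheses (G_le : forall i j, `|G i j| <= b) (m_le : forall i, `|m i| <= b).

Lemma frank_wolfe_rate (T : nat) (v : 'I_N -> R) : fw_run k xs m W T -> simplex v ->
  risk C G m (W T) <= risk C G m v + 16 * b / (T%:R + 2).
Proof.
move=> [init step] vs; elim: T step => [_|t IH step].
  have [i0 [_ ->]] := init; have b0 : 0 <= b by exact: le_trans (m_le i0).
  by apply: le_trans (risk_vertex_le C G_psd G_le m_le i0 vs) _; rewrite lerD2l add0r; lra.
have step' s : (s < t)%N -> _ := fun st => step s (ltnW st).
have Ws : simplex (W t) by exact: fw_run_simplex (conj init step').
have {IH} Wr := IH step'; have [i [i_min ->]] := step t (ltnSn t).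
have b0 : 0 <= b by exact: le_trans (m_le i).
move=> {step step' init}; have g01 := step_size_itv t; set g := 2 / (t%:R + 2) in g01 *.
have t0 : 0 <= t%:R :> R by exact: ler0n.
apply: le_trans (frank_wolfe_step C G_sym G_psd G_le g01 Ws vs i_min) _.
have [_ g1] := andP g01; have := ler_wpM2l (_ : 0 <= 1 - g) Wr; rewrite subr_ge0 => /(_ g1).
have gap_le : (1 - g) * (16 * b / (t%:R + 2)) + 4 * b * g ^+ 2 <= 16 * b / (t.+1%:R + 2).
  have -> : (1 - g) * (16 * b / (t%:R + 2)) + 4 * b * g ^+ 2 =
      16 * b * ((t%:R + 1) / (t%:R + 2) ^+ 2) by rewrite /g; field; lra.
  rewrite -natr1 ler_wpM2l ?mulr_ge0 // ler_pdivrMr ?exprn_gt0 ?ltr_wpDl // mulrC.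
  by rewrite ler_pdivlMr //; nra.
lra.
Qed.

End FrankWolfeRun.

Lemma cvg_sqr_dist_le (R : realType) (a b : nat -> R) (l : R) :
  (forall n, (a n - l) ^+ 2 <= b n) -> b @ \oo --> 0 -> a @ \oo --> l.
Proof.
move=> ab b0; apply/cvgrPdist_lt => eps eps0.
have /cvgrPdist_lt/(_ _ (exprn_gt0 2 eps0)) := b0; apply: filterS => n.
rewrite sub0r normrN => bn; rewrite -(ltr_pXn2r (ltn0Sn 1)) ?nnegrE ?(ltW eps0) //.
rewrite real_normK ?num_real // -sqrrN opprB.
exact: le_lt_trans (ab n) (le_lt_trans (ler_norm _) bn).
Qed.

Section BestApproximation.
Variables (R : realType) (I : Type) (H : set (I -> R)) (ip : (I -> R) -> (I -> R) -> R).
Hypothesis sip : semi_inner_product H ip.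
Let Hlin a f g : H f -> H g -> H (fun x => a * f x + g x).
Proof. by have [_] := sip_subspace sip; exact. Qed.
Let HB f g : H f -> H g -> H (fun x => f x - g x).
Proof. exact: linear_subspaceB (sip_subspace sip). Qed.

Lemma sip_cvg_l (u : nat -> I -> R) f h : (forall n, H (u n)) -> H f -> H h ->
  (fun n => sqdist ip (u n) f) @ \oo --> 0 -> (fun n => ip (u n) h) @ \oo --> ip f h.
Proof.
move=> Hu Hf Hh uf; apply: (@cvg_sqr_dist_le _ _ (fun n => sqdist ip (u n) f * ip h h)) => [n|].
  by rewrite -(sipBl sip) //; apply: (cauchy_schwarz sip) => //; exact: HB.
by rewrite -[0](mul0r (ip h h)); apply: cvgM => //; exact: cvg_cst.
Qed.

Lemma sip_cvg_self (u : nat -> I -> R) f : (forall n, H (u n)) -> H f ->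
  (fun n => sqdist ip (u n) f) @ \oo --> 0 -> (fun n => ip (u n) (u n)) @ \oo --> ip f f.
Proof.
move=> Hu Hf uf; have -> : (fun n => ip (u n) (u n)) =
    (fun n => sqdist ip (u n) f + (2 * ip (u n) f - ip f f)).
  by apply/funext => n; rewrite /sqdist (sipB_self sip) //; ring.
rewrite [X in _ --> X](_ : _ = 0 + (2 * ip f f - ip f f)); last by ring.
apply: cvgD => //; apply: cvgB; last exact: cvg_cst.
by apply: cvgM; [exact: cvg_cst|exact: sip_cvg_l].
Qed.

Section Subspace.
Variables (S : set (I -> R)) (f : I -> R).
Hypotheses (S_lin : linear_subspace S) (SH : S `<=` H) (Hf : H f).

(* Moving [u] along [v] improves the distance to [f] by at most [delta]. *)
Lemma near_minimizer_orthogonal (u v : I -> R) (delta : R) : S u -> S v ->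
  (forall g, S g -> sqdist ip f u <= sqdist ip f g + delta) ->
  ip (fun x => f x - u x) v ^+ 2 <= delta * ip v v.
Proof.
move=> Su Sv u_min; have [Hu Hv] := (SH Su, SH Sv).
rewrite mulrC -sqrrN -[- ip _ v]mulr1; apply: discriminant_le => [|t]; first exact: (sip_ge0 sip).
have := u_min _ (S_lin.2 t _ _ Sv Su); rewrite /sqdist.
have -> : (fun x => f x - (t * v x + u x)) = (fun x => - t * v x + (f x - u x)).
  by apply/funext => x; ring.
have Hfu := HB Hf Hu; rewrite (sip_linear_self sip) // (sip_sym sip Hv Hfu); lra.
Qed.

Lemma exists_minimizing_sequence : exists u : nat -> I -> R, forall n, S (u n) /\
  forall g, S g -> sqdist ip f (u n) <= sqdist ip f g + harmonic n.
Proof.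
have dist_inf : has_inf [set sqdist ip f g | g in S].
  split; first by exists (sqdist ip f (fun=> 0)), (fun=> 0) => //; exact: S_lin.1.
  by exists 0 => _ [g Sg <-]; apply: (sqdist_ge0 sip) => //; exact: SH.
suff /choice : forall n, exists u, S u /\
    forall g, S g -> sqdist ip f u <= sqdist ip f g + harmonic n.
  by case=> u u_min; exists u.
move=> n.
have [_ [u Su <-] u_lt] := inf_adherent (harmonic_gt0 n) dist_inf.
exists u; split=> // g Sg; apply: le_trans (ltW u_lt) _; rewrite lerD2r.
by apply: ge_inf; [case: dist_inf|exists g].
Qed.

Lemma minimizing_sequence_cauchy (u v : I -> R) (d d' : R) : S u -> S v ->
  (forall g, S g -> sqdist ip f u <= sqdist ip f g + d) ->
  (forall g, S g -> sqdist ip f v <= sqdist ip f g + d') ->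
  sqdist ip u v <= 2 * (d + d').
Proof.
move=> Su Sv u_min v_min; have [Hu Hv] := (SH Su, SH Sv).
pose z x := u x - v x; have Sz : S z by exact: linear_subspaceB.
have u_orth := near_minimizer_orthogonal Su Sz u_min.
have v_orth := near_minimizer_orthogonal Sv Sz v_min.
have zE : sqdist ip u v = ip (fun x => f x - v x) z - ip (fun x => f x - u x) z.
  rewrite -(sipBl sip (HB Hf Hv) (HB Hf Hu) (SH Sz)).
  by congr ip; apply/funext => x; rewrite /z; ring.
have := sqdist_ge0 sip Hu Hv; rewrite le_eqVlt => /predU1P[<-|z_gt0].
  have d0 : 0 <= d by have := u_min u Su; rewrite lerDl.
  have d'0 : 0 <= d' by have := v_min v Sv; rewrite lerDl.
  by rewrite mulr_ge0 ?addr_ge0.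
rewrite -(ler_pM2r z_gt0) {1}zE.
move: u_orth v_orth; rewrite -[ip z z]/(sqdist ip u v) zE => u_orth v_orth.
move: (ip _ z) (ip _ z) u_orth v_orth => a b; have := sqr_ge0 (a + b); nra.
Qed.

End Subspace.

End BestApproximation.

Section ReproducingKernelHilbertSpace.
Variables (R : realType) (X : Type) (k : X -> X -> R).
Variables (H : set (X -> R)) (ip : (X -> R) -> (X -> R) -> R).
Hypothesis rkhs : is_rkhs k H ip.

Lemma rkhs_sip : semi_inner_product H ip.
Proof. by have [? [? [? [? [ip_ge0 _]]]]] := rkhs; split=> // f /ip_ge0[]. Qed.

Lemma rkhs_kernel x : H (k x).
Proof. by have [_ [_ [_ [_ [_ [_ [Hk _]]]]]]] := rkhs; exact: Hk. Qed.

Lemma rkhs_reproducing f x : H f -> ip f (k x) = f x.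
Proof. by have [_ [_ [_ [_ [_ [_ [_ ipk]]]]]]] := rkhs; exact: ipk. Qed.

Lemma rkhs_complete (u : nat -> X -> R) : (forall n, H (u n)) ->
  (forall m n, sqdist ip (u m) (u n) <= 2 * (harmonic m + harmonic n)) ->
  exists2 g, H g & (fun n => sqdist ip (u n) g) @ \oo --> 0.
Proof.
move=> Hu u_cauchy; have [_ [_ [_ [_ [_ [compl _]]]]]] := rkhs.
have [|g [Hg ug]] := compl u Hu => [e e0|].
  have /cvgrPdist_lt/(_ (e / 4)) := @cvg_harmonic R.
  rewrite divr_gt0 // => /(_ isT)[M _ harmonic_lt].
  exists M => m n Mm Mn; apply: le_lt_trans (u_cauchy m n) _.
  have := harmonic_lt m Mm; have := harmonic_lt n Mn.
  by rewrite !sub0r !normrN !ger0_norm ?harmonic_ge0 //; lra.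
exists g => //; apply/cvgrPdist_lt => e /ug[M ug_lt]; exists M => // n /ug_lt.
by rewrite sub0r normrN ger0_norm // (sqdist_ge0 rkhs_sip).
Qed.

Definition kspan : set (X -> R) :=
  [set f | exists (J : finType) (c : J -> R) (z : J -> X), f = comb c (k \o z)].

Lemma kspan_subspace : linear_subspace kspan.
Proof.
split=> [|a _ _ [J [c [z ->]]] [J' [c' [z' ->]]]].
  by exists void, (fun=> 0), (of_void X); apply/funext => x; rewrite /comb /dot big1 // => -[].
exists (J + J')%type, (fun i => match i with inl j => a * c j | inr j => c' j end),
  (fun i => match i with inl j => z j | inr j => z' j end).
apply/funext => x; rewrite /comb /dot big_sumType /= mulr_sumr.
by congr (_ + _); apply: eq_bigr => j _; rewrite mulrA.
Qed.

Lemma kspan_rkhs : kspan `<=` H.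
Proof.
move=> _ [J [c [z ->]]]; apply: linear_subspace_comb (sip_subspace rkhs_sip) _ => i.
exact: rkhs_kernel.
Qed.

Lemma rkhs_cvg_pointwise (u : nat -> X -> R) f x : (forall n, H (u n)) -> H f ->
  (fun n => sqdist ip (u n) f) @ \oo --> 0 -> (fun n => u n x) @ \oo --> f x.
Proof.
move=> Hu Hf uf; rewrite -(rkhs_reproducing x Hf).
under eq_fun do rewrite -(rkhs_reproducing x (Hu _)).
exact: (sip_cvg_l rkhs_sip Hu Hf (rkhs_kernel x)).
Qed.

Lemma kspan_dense f : H f ->
  exists2 u : nat -> X -> R, forall n, kspan (u n) & (fun n => sqdist ip (u n) f) @ \oo --> 0.
Proof.
move=> Hf.
have [u u_min] := exists_minimizing_sequence rkhs_sip kspan_subspace kspan_rkhs Hf.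
have Su n : kspan (u n) := (u_min n).1; have Hu n := kspan_rkhs (Su n).
have [g Hg ug] := rkhs_complete Hu (fun m n => minimizing_sequence_cauchy rkhs_sip
  kspan_subspace kspan_rkhs Hf (Su m) (Su n) (u_min m).2 (u_min n).2).
suff -> : f = g by exists u.
apply/funext => x; apply: (@cvg_unique _ (@Rhausdorff R) ((fun n => u n x) @ \oo)); last first.
  exact: rkhs_cvg_pointwise Hu Hg ug.
apply: (@cvg_sqr_dist_le _ _ (fun n => harmonic n * k x x)) => [n|]; last first.
  by rewrite -[0](mul0r (k x x)); apply: cvgM; [exact: cvg_harmonic|exact: cvg_cst].
have Skx : kspan (k x).
  by exists unit, (vertex tt), (fun=> x); apply/funext => y; rewrite /comb dot_vertexl.
have := near_minimizer_orthogonal rkhs_sip kspan_subspace kspan_rkhs Hf (Su n) Skx (u_min n).2.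
have Hfu := linear_subspaceB (sip_subspace rkhs_sip) Hf (Hu n).
by rewrite (rkhs_reproducing _ Hfu) (rkhs_reproducing _ (rkhs_kernel x)) -sqrrN opprB.
Qed.

End ReproducingKernelHilbertSpace.

Section WeightedSequences.
Variables (R : realType) (s : nat -> R).
Hypothesis s_ge0 : forall j, 0 <= s j.
Implicit Types u v : nat -> R.

Definition wdot_cvg u v (l : R) : Prop := (fun n => wdot s (index_iota 0 n) u v) @ \oo --> l.

Lemma wdot_split (m n : nat) u v : (m <= n)%N ->
  wdot s (index_iota 0 n) u v = wdot s (index_iota 0 m) u v + wdot s (index_iota m n) u v.
Proof. by move=> mn; rewrite /wdot (big_cat_nat (leq0n m) mn). Qed.

Lemma wdot_self_ge0 (r : seq nat) u : 0 <= wdot s r u u.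
Proof. exact: (sip_ge0 (wdot_sip r s_ge0)). Qed.

Lemma wdot_nondecreasing u : nondecreasing_seq (fun n => wdot s (index_iota 0 n) u u).
Proof. by move=> m n mn; rewrite (wdot_split _ _ mn) lerDl wdot_self_ge0. Qed.

Lemma wdot_cvg_sym u v l : wdot_cvg u v l -> wdot_cvg v u l.
Proof. by rewrite /wdot_cvg; under eq_fun do rewrite (sip_sym (wdot_sip _ s_ge0)) //. Qed.

Lemma wdot_cvg_uniq u v l l' : wdot_cvg u v l -> wdot_cvg u v l' -> l = l'.
Proof. exact: (@cvg_unique _ (@Rhausdorff R)). Qed.

Lemma wdot_cvg_le u n l : wdot_cvg u u l -> wdot s (index_iota 0 n) u u <= l.
Proof.
move=> ul; apply: (cvgr_to_ge ul); exists n => // m nm; exact: wdot_nondecreasing.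
Qed.

Lemma wdot_cvg_combr (J : finType) u (w : J -> R) (F : J -> nat -> R) (l : J -> R) :
  (forall i, wdot_cvg u (F i) (l i)) -> wdot_cvg u (comb w F) (dot w l).
Proof.
move=> uF; rewrite /wdot_cvg; under eq_fun do rewrite (sip_comb_r (wdot_sip _ s_ge0)) //.
apply: cvg_big => [|i _]; first exact: add_continuous.
by apply: cvgM; [exact: cvg_cst|exact: uF].
Qed.

Lemma wdot_cvg_combl (J : finType) u (w : J -> R) (F : J -> nat -> R) (l : J -> R) :
  (forall i, wdot_cvg (F i) u (l i)) -> wdot_cvg (comb w F) u (dot w l).
Proof. by move=> Fu; apply/wdot_cvg_sym/wdot_cvg_combr => i; apply: wdot_cvg_sym. Qed.

Lemma wdot_cvgBr u v v' l l' : wdot_cvg u v l -> wdot_cvg u v' l' ->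
  wdot_cvg u (fun j => v j - v' j) (l - l').
Proof.
move=> uv uv'; rewrite /wdot_cvg; under eq_fun do rewrite (sipBr (wdot_sip _ s_ge0)) //.
exact: cvgB.
Qed.

Lemma wdot_cvgB_self u v a b c : wdot_cvg u u a -> wdot_cvg u v b -> wdot_cvg v v c ->
  wdot_cvg (fun j => u j - v j) (fun j => u j - v j) (a - 2 * b + c).
Proof.
move=> uu uv vv; rewrite /wdot_cvg; under eq_fun do rewrite (sipB_self (wdot_sip _ s_ge0)) //.
by apply: cvgD => //; apply: cvgB => //; apply: cvgM => //; exact: cvg_cst.
Qed.

Lemma wdot_cvg_cauchy_schwarz u v a b c :
  wdot_cvg u u a -> wdot_cvg v v b -> wdot_cvg u v c -> c ^+ 2 <= a * b.
Proof.
move=> uu vv uv; rewrite -subr_ge0 expr2; apply: (cvgr_to_ge (cvgB (cvgM uu vv) (cvgM uv uv))).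
by apply: nearW => n; rewrite subr_ge0 /= -expr2 (cauchy_schwarz (wdot_sip _ s_ge0)).
Qed.

End WeightedSequences.

Section Mercer.
Variables (R : realType) (dX : measure_display) (X : measurableType dX).
Variables (mu : probability X R) (k : X -> X -> R) (sigma : nat -> R) (e : nat -> X -> R).
Variable b : R.
Hypotheses (e_on : orthonormal_L2 mu e) (sigma_ge0 : forall j, 0 <= sigma j).
Hypothesis mercer : forall x y, wdot_cvg sigma (e^~ x) (e^~ y) (k x y).
Hypothesis k_le : forall x, k x x <= b.

Lemma kernel_sym x y : k x y = k y x.
Proof. exact: wdot_cvg_uniq (@mercer x y) (wdot_cvg_sym sigma_ge0 (@mercer y x)). Qed.

Lemma wdot_le_kernel n x : wdot sigma (index_iota 0 n) (e^~ x) (e^~ x) <= k x x.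
Proof. exact: wdot_cvg_le. Qed.

Lemma kernel_diag_ge0 x : 0 <= k x x.
Proof. by apply: le_trans (wdot_le_kernel 0 x); rewrite wdot_self_ge0. Qed.

Lemma kernel_norm_le x y : `|k x y| <= b.
Proof.
have b0 : 0 <= b by exact: le_trans (kernel_diag_ge0 x) (k_le x).
rewrite -(ler_pXn2r (ltn0Sn 1)) ?nnegrE // real_normK ?num_real //.
apply: le_trans (wdot_cvg_cauchy_schwarz sigma_ge0 (@mercer x x) (@mercer y y) (@mercer x y)) _.
by rewrite expr2 ler_pM ?kernel_diag_ge0.
Qed.

Lemma wdot_mercer_norm_le n x y : `|wdot sigma (index_iota 0 n) (e^~ x) (e^~ y)| <= b.
Proof.
have b0 : 0 <= b by exact: le_trans (kernel_diag_ge0 x) (k_le x).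
rewrite -[b]sqr_sqrtr // expr2; apply: (cauchy_schwarz_le (wdot_sip _ sigma_ge0));
  rewrite ?sqrtr_ge0 ?sqr_sqrtr //; exact: le_trans (wdot_le_kernel _ _) (k_le _).
Qed.

Lemma e_measurable j : measurable_fun setT (e j).
Proof. by case: e_on. Qed.

Lemma wdot_measurable (r : seq nat) (f g : nat -> X -> R) :
  (forall j, measurable_fun setT (f j)) -> (forall j, measurable_fun setT (g j)) ->
  measurable_fun setT (fun x => wdot sigma r (f^~ x) (g^~ x)).
Proof.
move=> mf mg; apply: measurable_sum => j.
by apply: measurable_funM => //; exact: measurable_funM.
Qed.

Lemma kernel_measurable y : measurable_fun setT (k^~ y).
Proof.
pose partial n x := wdot sigma (index_iota 0 n) (e^~ x) (e^~ y).
apply: (measurable_fun_cvg (h := partial)) => [n|x _].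
  exact: (wdot_measurable (g := fun j _ => e j y) _ e_measurable).
exact: mercer.
Qed.

Lemma kernel_diag_measurable : measurable_fun setT (fun x => k x x).
Proof.
pose partial n x := wdot sigma (index_iota 0 n) (e^~ x) (e^~ x).
apply: (measurable_fun_cvg (h := partial)) => [n|x _].
  exact: wdot_measurable e_measurable e_measurable.
exact: mercer.
Qed.

Lemma kernel_diag_integrable : mu.-integrable setT (EFin \o (fun x => k x x)).
Proof. exact: bounded_integrable kernel_diag_measurable (fun x => kernel_norm_le x x). Qed.

Lemma e_sq_integrable j : mu.-integrable setT (EFin \o (fun x => e j x ^+ 2)).
Proof.
apply/integrableP; split.
  by apply/measurable_EFinP; apply: measurable_funX; exact: e_measurable.
have [_ /(_ j j)] := e_on; rewrite eqxx => e_norm.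
rewrite (_ : integral _ _ _ = (\int[mu]_x (e j x * e j x)%:E)%E); first by rewrite e_norm ltry.
by apply: eq_integral => x _ /=; rewrite ger0_norm ?sqr_ge0 // expr2.
Qed.

Lemma e_sq_integral j : \int[mu]_x (e j x ^+ 2) = 1.
Proof.
have [_ /(_ j j)] := e_on; rewrite eqxx /Rintegral => e_norm.
by under eq_integral do rewrite expr2; rewrite e_norm.
Qed.

Lemma e_integrable j : mu.-integrable setT (EFin \o e j).
Proof.
apply: (le_integrable measurableT (g := EFin \o (fun x => 1 + e j x ^+ 2))).
- exact/measurable_EFinP/e_measurable.
- move=> x _ /=; rewrite lee_fin [leRHS]ger0_norm ?addr_ge0 ?sqr_ge0 //.
  by rewrite ler_norml; have := sqr_ge0 (e j x - 1); have := sqr_ge0 (e j x + 1); lra.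
- exact: (integrableD measurableT (cst_integrable mu 1) (e_sq_integrable j)).
Qed.

Definition emean (j : nat) : R := \int[mu]_x e j x.

Lemma emean_sq_le1 j : emean j ^+ 2 <= 1.
Proof.
rewrite -(e_sq_integral j); apply: Rintegral_sq_le; first exact: e_integrable.
exact: e_sq_integrable.
Qed.

Lemma kme_mercer z : wdot_cvg sigma emean (e^~ z) (kme mu k z).
Proof.
rewrite /wdot_cvg (_ : (fun n => _) =
    fun n => \int[mu]_x wdot sigma (index_iota 0 n) (e^~ x) (e^~ z)).
  apply: (dominated_cvg_Rintegral (c := b)) => [n|n x|x]; last exact: mercer.
    exact: (wdot_measurable (g := fun j _ => e j z) _ e_measurable).
  exact: wdot_mercer_norm_le.
apply/funext => n; rewrite Rintegral_sumr => [|j]; last first.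
  rewrite (_ : (fun x => _) = (fun x => sigma j * e j z * e j x)).
    exact: (integrableZl measurableT _ (e_integrable j)).
  by apply/funext => x; rewrite mulrAC.
apply: eq_bigr => j _; under eq_Rintegral do rewrite mulrAC.
by rewrite RintegralZl ?(mulrAC _ (e j z)) //; exact: e_integrable.
Qed.

Lemma kernel_trace : (fun n => \sum_(0 <= j < n) sigma j) @ \oo --> \int[mu]_x k x x.
Proof.
rewrite (_ : (fun n => _) = fun n => \int[mu]_x wdot sigma (index_iota 0 n) (e^~ x) (e^~ x)).
  apply: (dominated_cvg_Rintegral (c := b)) => [n|n x|x]; last exact: mercer.
    exact: wdot_measurable e_measurable e_measurable.
  exact: wdot_mercer_norm_le.
apply/funext => n; have sq j : (fun x => sigma j * e j x * e j x) = (fun x => sigma j * e j x ^+ 2).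
  by apply/funext => x; rewrite expr2 mulrA.
rewrite Rintegral_sumr => [|j]; last first.
  by rewrite sq; exact: (integrableZl measurableT _ (e_sq_integrable j)).
apply: eq_bigr => j _; rewrite sq RintegralZl ?e_sq_integral ?mulr1 //; exact: e_sq_integrable.
Qed.

Lemma sum_sigma_le_trace n : \sum_(0 <= j < n) sigma j <= \int[mu]_x k x x.
Proof.
apply: (cvgr_to_ge kernel_trace); exists n => // m nm.
by rewrite [leRHS](big_cat_nat (leq0n n) nm) lerDl sumr_ge0.
Qed.

Lemma kme_norm_le z : `|kme mu k z| <= b.
Proof. exact: (@Rintegral_norm_le _ _ _ mu _ _ (kernel_measurable z) (kernel_norm_le^~ z)). Qed.

Lemma wdot_emean_le (r : seq nat) : wdot sigma r emean emean <= \sum_(j <- r) sigma j.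
Proof.
apply: ler_sum => j _; rewrite -mulrA -expr2 -[leRHS]mulr1.
by rewrite ler_wpM2l // emean_sq_le1.
Qed.

Definition embed_sq : R := limn (fun n => wdot sigma (index_iota 0 n) emean emean).

Lemma embed_sq_cvg : wdot_cvg sigma emean emean embed_sq.
Proof.
apply: nondecreasing_is_cvgn; first exact: wdot_nondecreasing.
exists (\int[mu]_x k x x) => _ [n _ <-].
exact: le_trans (wdot_emean_le _) (sum_sigma_le_trace n).
Qed.

Section QuadratureRisk.
Variables (J : finType) (xs : J -> X) (w : J -> R).

Definition quad_risk : R :=
  risk embed_sq (fun i j => k (xs i) (xs j)) (fun i => kme mu k (xs i)) w.

Definition coef_gap : nat -> R := fun j => emean j - comb w (fun i => e^~ (xs i)) j.

Lemma quad_risk_cvg : wdot_cvg sigma coef_gap coef_gap quad_risk.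
Proof.
apply: (wdot_cvgB_self sigma_ge0); first exact: embed_sq_cvg.
  by apply: (wdot_cvg_combr sigma_ge0) => i; exact: kme_mercer.
by apply: (wdot_cvg_combl sigma_ge0) => i; apply: (wdot_cvg_combr sigma_ge0) => j; exact: mercer.
Qed.

Lemma quad_risk_ge0 : 0 <= quad_risk.
Proof. by apply: (cvgr_to_ge quad_risk_cvg); apply: nearW => n; exact: wdot_self_ge0. Qed.

(* Cauchy-Schwarz between the Mercer coefficients of [comb c (k \o z)] and [coef_gap]. *)
Lemma quad_gap_sq_le (I : finType) (c : I -> R) (z : I -> X) :
  dot c (fun a => kme mu k (z a) - dot w (fun i => k (xs i) (z a))) ^+ 2 <=
  qform (fun a a' => k (z a) (z a')) c c * quad_risk.
Proof.
pose V := comb c (fun a => e^~ (z a)).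
apply: (wdot_cvg_cauchy_schwarz sigma_ge0 (u := V)) quad_risk_cvg _.
  apply: (wdot_cvg_combl sigma_ge0) => a; apply: (wdot_cvg_combr sigma_ge0) => a'.
  exact: mercer.
apply: (wdot_cvg_combl sigma_ge0) => a; apply: (wdot_cvgBr sigma_ge0).
  by apply: (wdot_cvg_sym sigma_ge0); exact: kme_mercer.
apply: (wdot_cvg_combr sigma_ge0) => i; rewrite kernel_sym; exact: mercer.
Qed.

End QuadratureRisk.

Section WorstCaseError.
Variables (H : set (X -> R)) (ip : (X -> R) -> (X -> R) -> R).
Hypothesis rkhs : is_rkhs k H ip.
Let sip := rkhs_sip rkhs.

Lemma kspan_measurable f : kspan k f -> measurable_fun setT f.
Proof.
move=> [J [c [z ->]]]; apply: measurable_sum => a; apply: measurable_funM => //=.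
have -> : k (z a) = k^~ (z a) by apply/funext => x; exact: kernel_sym.
exact: kernel_measurable.
Qed.

Lemma rkhs_measurable f : H f -> measurable_fun setT f.
Proof.
move=> Hf; have [u Su uf] := kspan_dense rkhs Hf.
apply: measurable_fun_cvg (fun n => kspan_measurable (Su n)) _ => x _.
have Hu n := kspan_rkhs rkhs (Su n); exact: (rkhs_cvg_pointwise rkhs Hu Hf uf).
Qed.

Lemma rkhs_sq_le f x : H f -> f x ^+ 2 <= ip f f * b.
Proof.
move=> Hf; have Hk := rkhs_kernel rkhs x; rewrite -(rkhs_reproducing rkhs x Hf).
apply: le_trans (cauchy_schwarz sip Hf Hk) _.
by rewrite ler_wpM2l ?(sip_ge0 sip) // (rkhs_reproducing rkhs).
Qed.

Lemma rkhs_norm_le f x : H f -> `|f x| <= Num.sqrt (ip f f * b).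
Proof. by move=> Hf; rewrite -sqrtr_sqr ler_wsqrtr // rkhs_sq_le. Qed.

Lemma rkhs_integrable f : H f -> mu.-integrable setT (EFin \o f).
Proof.
move=> Hf; exact: (bounded_integrable mu (rkhs_measurable Hf) (fun x => rkhs_norm_le x Hf)).
Qed.

Lemma rkhs_Rintegral_sq_le f : H f -> (\int[mu]_x f x) ^+ 2 <= ip f f * b.
Proof.
move=> Hf; have mf2 : measurable_fun setT (fun x => f x ^+ 2).
  exact/measurable_funX/rkhs_measurable.
have f2_le x : `|f x ^+ 2| <= ip f f * b by rewrite ger0_norm ?sqr_ge0 // rkhs_sq_le.
apply: le_trans (Rintegral_sq_le (rkhs_integrable Hf) (bounded_integrable mu mf2 f2_le)) _.
exact: le_trans (ler_norm _) (Rintegral_norm_le mu mf2 f2_le).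
Qed.

Section QuadratureError.
Variables (J : finType) (xs : J -> X) (w : J -> R).

Definition quad_error (f : X -> R) : R := \int[mu]_x f x - dot w (f \o xs).

Lemma rkhs_cvg_quad_error (u : nat -> X -> R) f : (forall n, H (u n)) -> H f ->
  (fun n => sqdist ip (u n) f) @ \oo --> 0 ->
  (fun n => quad_error (u n)) @ \oo --> quad_error f.
Proof.
move=> Hu Hf uf; apply: cvgB; last first.
  apply: cvg_big => [|i _]; first exact: add_continuous.
  by apply: cvgM; [exact: cvg_cst|exact: (rkhs_cvg_pointwise rkhs Hu Hf uf)].
apply: (cvg_sqr_dist_le (b := fun n => sqdist ip (u n) f * b)) => [n|]; last first.
  by rewrite -[0](mul0r b); apply: cvgM => //; exact: cvg_cst.
have Huf := linear_subspaceB (sip_subspace sip) (Hu n) Hf.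
by rewrite -RintegralB ?rkhs_integrable //; exact: rkhs_Rintegral_sq_le.
Qed.

Lemma kspan_quad_error_sq_le f : kspan k f ->
  quad_error f ^+ 2 <= ip f f * quad_risk xs w.
Proof.
move=> Sf; have Hf := kspan_rkhs rkhs Sf; case: Sf Hf => J' [c [z ->]] Hf.
have Hkz a : H ((k \o z) a) by exact: (rkhs_kernel rkhs).
have -> : quad_error (comb c (k \o z)) =
    dot c (fun a => kme mu k (z a) - dot w (fun i => k (xs i) (z a))).
  rewrite /quad_error (Rintegral_dot _ (f := k \o z)) => [|a]; last exact: rkhs_integrable.
  rewrite [X in _ - X](dot_combr w c (fun a i => k (z a) (xs i))) -dotBr.
  congr dot; apply/funext => a; congr (_ - _).
    by apply: eq_Rintegral => x _; exact: kernel_sym.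
  by apply: eq_bigr => i _; rewrite kernel_sym.
have -> : ip (comb c (k \o z)) (comb c (k \o z)) = qform (fun a a' => k (z a) (z a')) c c.
  rewrite (sip_comb_l sip) //; apply: eq_bigr => a _; congr (_ * _).
  rewrite (sip_comb_r sip) //; apply: eq_bigr => a' _; congr (_ * _).
  by rewrite (rkhs_reproducing rkhs).
exact: quad_gap_sq_le.
Qed.

Lemma rkhs_quad_error_sq_le f : H f ->
  quad_error f ^+ 2 <= ip f f * quad_risk xs w.
Proof.
move=> Hf; have [u Su uf] := kspan_dense rkhs Hf.
have Hu n := kspan_rkhs rkhs (Su n).
have err := rkhs_cvg_quad_error Hu Hf uf.
have nrm := sip_cvg_self sip Hu Hf uf.
rewrite -subr_ge0 [X in _ - X]expr2; apply: (cvgr_to_ge (cvgB (cvgMl nrm) (cvgM err err))).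
by apply: nearW => n; rewrite subr_ge0 /= -expr2; exact: kspan_quad_error_sq_le.
Qed.

End QuadratureError.

Lemma wce_le (N : nat) (xs : 'I_N -> X) (w : 'I_N -> R) :
  (wce mu H ip xs w <= (Num.sqrt (quad_risk xs w))%:E)%E.
Proof.
apply: ge_ereal_sup => _ [f [Hf f_le1] <-].
have -> : (\int[mu]_x (f x)%:E)%E = (\int[mu]_x f x)%:E.
  by rewrite /Rintegral fineK // (integrable_fin_num measurableT (rkhs_integrable Hf)).
rewrite -EFinB lee_fin -sqrtr_sqr ler_wsqrtr //.
apply: le_trans (rkhs_quad_error_sq_le xs w Hf) _; rewrite -[leRHS]mul1r ler_wpM2r //.
exact: quad_risk_ge0.
Qed.

End WorstCaseError.

Section Features.
Variable dd : nat.

Definition resid (x : X) : R := Num.sqrt (k x x - wdot sigma (index_iota 0 dd) (e^~ x) (e^~ x)).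

(* The first [dd] Mercer features of [x], followed by the norm of the remaining ones. *)
Definition feat (x : X) (i : 'I_dd + unit) : R :=
  match i with inl j => Num.sqrt (sigma j) * e j x | inr _ => resid x end.

Definition sigma_tail : R := limn (fun n => \sum_(dd <= j < n) sigma j).

Lemma resid_sq x : resid x ^+ 2 = k x x - wdot sigma (index_iota 0 dd) (e^~ x) (e^~ x).
Proof. by rewrite sqr_sqrtr // subr_ge0; exact: wdot_le_kernel. Qed.

Lemma wdot_tail_le_resid n x : (dd <= n)%N ->
  wdot sigma (index_iota dd n) (e^~ x) (e^~ x) <= resid x ^+ 2.
Proof.
move=> dn; rewrite resid_sq lerBrDl -wdot_split //; exact: wdot_le_kernel.
Qed.

Lemma feat_dot x : dot (feat x) (feat x) = k x x.
Proof.
rewrite /dot big_sumType /= (big_pred1 tt) => [|[]//]; rewrite -expr2 resid_sq.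
rewrite /wdot big_mkord addrC -[RHS](subrK (\sum_(i < dd) sigma i * e i x * e i x)); congr (_ + _).
by apply: eq_bigr => j _; rewrite mulrACA -expr2 sqr_sqrtr // mulrA.
Qed.

Lemma resid_measurable : measurable_fun setT resid.
Proof.
apply: measurableT_comp; first exact: (continuous_measurable_fun (@sqrt_continuous R)).
apply: measurable_funB; first exact: kernel_diag_measurable.
exact: wdot_measurable e_measurable e_measurable.
Qed.

Lemma feat_measurable i : measurable_fun setT (feat^~ i).
Proof.
case: i => [j|[]]; last exact: resid_measurable.
by apply: measurable_funM => //; exact: e_measurable.
Qed.

Lemma feat_mean_inl j : vec_mean mu feat (inl j) = Num.sqrt (sigma j) * emean j.
Proof. by rewrite /vec_mean /= RintegralZl //; exact: e_integrable. Qed.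

Lemma sigma_tailE : sigma_tail = \int[mu]_x k x x - \sum_(0 <= j < dd) sigma j.
Proof.
apply: cvg_lim => //.
have : (fun n => \sum_(0 <= j < n) sigma j - \sum_(0 <= j < dd) sigma j) @ \oo -->
    \int[mu]_x k x x - \sum_(0 <= j < dd) sigma j.
  by apply: cvgB; [exact: kernel_trace|exact: cvg_cst].
apply: cvg_trans; apply: near_eq_cvg; exists dd => // n /= dn.
by rewrite (big_cat_nat (leq0n dd) dn) /= addrAC subrr add0r.
Qed.

Lemma sum_sigma_tail_le n : (dd <= n)%N -> \sum_(dd <= j < n) sigma j <= sigma_tail.
Proof.
move=> dn; rewrite sigma_tailE lerBrDl -(big_cat_nat (leq0n dd) dn).
exact: sum_sigma_le_trace.
Qed.

Lemma sigma_tail_ge0 : 0 <= sigma_tail.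
Proof. by apply: le_trans (sum_sigma_tail_le (leqnn dd)); rewrite big_geq. Qed.

Lemma resid_sq_integral : \int[mu]_x (resid x ^+ 2) = sigma_tail.
Proof.
pose sq j x := sigma j * e j x ^+ 2.
have sqi j : mu.-integrable setT (EFin \o sq j).
  exact: (integrableZl measurableT _ (e_sq_integrable j)).
transitivity (\int[mu]_x (k x x - \sum_(0 <= j < dd) sq j x)).
  apply: eq_Rintegral => x _; rewrite resid_sq; congr (_ - _).
  by apply: eq_bigr => j _; rewrite -mulrA -expr2.
rewrite RintegralB //; last 2 first.
- exact: kernel_diag_integrable.
- exact: integrable_sumr.
rewrite sigma_tailE Rintegral_sumr //; congr (_ - _); apply: eq_bigr => j _.
by rewrite RintegralZl ?e_sq_integral ?mulr1 //; exact: e_sq_integrable.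
Qed.

Lemma feat_mean_inr_le : vec_mean mu feat (inr tt) <= Num.sqrt sigma_tail.
Proof.
have mr := resid_measurable; have mr2 : measurable_fun setT (fun x => resid x ^+ 2).
  exact: measurable_funX.
have r2_le x : resid x ^+ 2 <= b.
  by apply: le_trans (k_le x); rewrite resid_sq gerBl wdot_self_ge0.
have ri : mu.-integrable setT (EFin \o resid).
  apply: (bounded_integrable mu mr (c := Num.sqrt b)) => x.
  by rewrite -sqrtr_sqr ler_wsqrtr // r2_le.
have r2i : mu.-integrable setT (EFin \o (fun x => resid x ^+ 2)).
  by apply: (bounded_integrable mu mr2 (c := b)) => x; rewrite ger0_norm ?sqr_ge0 // r2_le.
apply: le_trans (ler_norm _) _; rewrite -sqrtr_sqr ler_wsqrtr // -resid_sq_integral.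
exact: Rintegral_sq_le.
Qed.

Section Weights.
Variables (J : finType) (xs : J -> X) (w : J -> R).
Let gap := coef_gap xs w.
Let last_gap := dot w (resid \o xs) - vec_mean mu feat (inr tt).

Lemma sqdist_feat_mean : sqdist (@dot R _) (comb w (feat \o xs)) (vec_mean mu feat) =
  wdot sigma (index_iota 0 dd) gap gap + last_gap ^+ 2.
Proof.
rewrite /sqdist {1}/dot big_sumType (big_pred1 tt) => [|[]//]; congr (_ + _).
rewrite /wdot big_mkord; apply: eq_bigr => j _; rewrite feat_mean_inl.
have -> : comb w (feat \o xs) (inl j) = Num.sqrt (sigma j) * comb w (fun i => e^~ (xs i)) j.
  by rewrite /comb /dot mulr_sumr; apply: eq_bigr => i _; rewrite mulrCA.
by rewrite -mulrBr -expr2 exprMn sqr_sqrtr // -mulrA -expr2 -sqrrN opprB.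
Qed.

Hypothesis w_simplex : simplex w.

Lemma wdot_tail_gap_le n : (dd <= n)%N ->
  wdot sigma (index_iota dd n) gap gap <= (Num.sqrt sigma_tail + dot w (resid \o xs)) ^+ 2.
Proof.
move=> dn; have wsip := wdot_sip (index_iota dd n) sigma_ge0.
have resid_ge0 i : 0 <= resid (xs i) by exact: sqrtr_ge0.
apply: (sipB_self_le wsip) => //.
- exact: dot_simplex_ge.
- rewrite sqr_sqrtr ?sigma_tail_ge0 //.
  exact: le_trans (wdot_emean_le _) (sum_sigma_tail_le dn).
- by apply: (sip_comb_self_le wsip) => // i; exact: wdot_tail_le_resid.
Qed.

Lemma quad_risk_le_feat (beta : R) : 0 <= beta ->
  sqdist (@dot R _) (comb w (feat \o xs)) (vec_mean mu feat) <= beta ^+ 2 ->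
  quad_risk xs w <= (2 * Num.sqrt sigma_tail + beta) ^+ 2.
Proof.
move=> beta0; rewrite sqdist_feat_mean; set t := Num.sqrt sigma_tail.
set head := wdot _ _ _ _ => feat_le; have t0 : 0 <= t by exact: sqrtr_ge0.
have head0 : 0 <= head by exact: wdot_self_ge0.
have z0 : 0 <= dot w (resid \o xs) by apply: dot_simplex_ge => // i; exact: sqrtr_ge0.
have norm_sq : `|last_gap| ^+ 2 = last_gap ^+ 2 by rewrite real_normK ?num_real.
have last_le : `|last_gap| <= beta.
  by rewrite -(ler_pXn2r (ltn0Sn 1)) ?nnegrE // norm_sq (le_trans _ feat_le) // lerDr.
have tail_le : (t + dot w (resid \o xs)) ^+ 2 <= (2 * t + `|last_gap|) ^+ 2.
  rewrite ler_pXn2r ?nnegrE ?addr_ge0 ?mulr_ge0 //.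
  by have := ler_norm last_gap; have := feat_mean_inr_le; rewrite /last_gap -/t; lra.
have t_last_le : t * `|last_gap| <= t * beta by rewrite ler_wpM2l.
have risk_cvg : wdot_cvg sigma gap gap (quad_risk xs w).
  exact: quad_risk_cvg.
apply: (cvgr_to_le risk_cvg); exists dd => // n dn.
rewrite (wdot_split _ _ _ dn) -/gap -/head.
have := wdot_tail_gap_le dn; move: feat_le tail_le t_last_le; rewrite -norm_sq -/t.
lra.
Qed.

End Weights.

End Features.

End Mercer.

Section GoodSample.
Variables (R : realType) (dX dO : measure_display) (X : measurableType dX).
Variables (Omega : measurableType dO) (mu : probability X R) (P : probability Omega R).
Variables (k : X -> X -> R) (sigma : nat -> R) (e : nat -> X -> R) (kap : R).
Hypotheses (e_on : orthonormal_L2 mu e) (sigma_ge0 : forall j, 0 <= sigma j).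
Hypothesis mercer : forall x y, wdot_cvg sigma (e^~ x) (e^~ y) (k x y).
Hypotheses (kap_ge0 : 0 <= kap) (k_le : forall x, k x x <= kap ^+ 2).

Lemma iid_exists_good_weights (N n dd : nat) (Xs : 'I_N -> Omega -> X) :
  iid_with_law P mu Xs -> (0 < n)%N -> (6 * dd.+1 * n <= N)%N ->
  exists E : set Omega, [/\ measurable E, ((1 - 2 ^- dd.+1)%:E <= P E)%E &
    forall om, E om -> exists2 w, simplex w &
      quad_risk mu k sigma e (Xs^~ om) w <=
        (2 * Num.sqrt (sigma_tail sigma dd) + 4 * kap / n%:R) ^+ 2].
Proof.
move=> iid n0 nN; have cardI : #|{: 'I_dd + unit}| = dd.+1.
  by rewrite card_sum card_ord card_unit addn1.
pose phi : X -> 'I_dd + unit -> R := @feat _ _ _ k sigma e dd.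
have phi_le x : dot (phi x) (phi x) <= kap ^+ 2 by rewrite feat_dot.
have := iid_hull_near_mean (feat_measurable (dd := dd) e_on mercer) kap_ge0 phi_le iid.
rewrite cardI => /(_ n)[//|//|//|E [mE PE hullE]]; exists E; split=> // om /hullE[w ws hull].
exists w => //; apply: (quad_risk_le_feat e_on sigma_ge0 mercer k_le ws _ hull).
by rewrite divr_ge0 ?mulr_ge0.
Qed.

End GoodSample.

Section KernelBound.
Variables (R : realType) (X : Type) (k : X -> X -> R).

Lemma pd_kernel_qform_ge0 (N : nat) (xs : 'I_N -> X) (u : 'I_N -> R) :
  pd_kernel k -> 0 <= qform (fun i j => k (xs i) (xs j)) u u.
Proof.
move=> [_ k_psd]; have := k_psd N u xs; congr (_ <= _); apply: eq_bigr => i _.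
by rewrite /dot mulr_sumr; apply: eq_bigr => j _; rewrite mulrA.
Qed.

Hypothesis k_bounded : has_ubound (range (fun x => Num.sqrt (k x x))).

Lemma sqrt_kernel_le_kappa x : Num.sqrt (k x x) <= kappa k.
Proof. by apply: (ub_le_sup k_bounded); exists x. Qed.

Lemma kappa_ge0 : 0 <= kappa k.
Proof.
have [[x _]|X0] := pselect (exists x : X, True).
  exact: le_trans (sqrtr_ge0 _) (sqrt_kernel_le_kappa x).
have no_value : range (fun x => Num.sqrt (k x x)) = set0.
  by apply/seteqP; split=> // y [x _ _]; apply: X0; exists x.
by rewrite /kappa no_value sup0.
Qed.

Lemma kernel_diag_le_kappa x : 0 <= k x x -> k x x <= kappa k ^+ 2.
Proof.
move=> k0; rewrite -[leLHS]sqr_sqrtr // lerXn2r ?nnegrE ?kappa_ge0 //.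
exact: sqrt_kernel_le_kappa.
Qed.

End KernelBound.

Lemma sqrtr_le_add (R : rcfType) (r a b : R) :
  0 <= a -> 0 <= b -> r <= a ^+ 2 + b ^+ 2 -> Num.sqrt r <= a + b.
Proof.
move=> a0 b0 r_le; rewrite -[leRHS]ger0_norm ?addr_ge0 // -sqrtr_sqr ler_wsqrtr //.
by apply: le_trans r_le _; rewrite sqrrD lerD2r lerDl mulrn_wge0 // mulr_ge0.
Qed.

Theorem theorem8 (R : realType) (dX : measure_display) (X : measurableType dX)
  (mu : probability X R) (k : X -> X -> R)
  (H : set (X -> R)) (ip : (X -> R) -> (X -> R) -> R)
  (sigma : nat -> R) (e : nat -> X -> R)
  (dO : measure_display) (Omega : measurableType dO) (P : probability Omega R)
  (N dd T : nat) (Xs : 'I_N -> Omega -> X) :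
  pd_kernel k ->
  is_rkhs k H ip ->
  has_ubound (range (fun x => Num.sqrt (k x x))) ->
  orthonormal_L2 mu e ->
  (forall j, sigma j.+1 <= sigma j) -> (forall j, 0 <= sigma j) ->
  (forall x y, (fun n => \sum_(0 <= j < n) sigma j * e j x * e j y) @ \oo --> k x y) ->
  (0 < N)%N -> (0 < dd)%N -> (6 * dd.+1 <= N)%N ->
  iid_with_law P mu Xs ->
  exists E : set Omega, measurable E /\
    (P E >= (1 - 2 ^- dd.+1)%:E)%E /\
    forall om, E om ->
      let xs := fun i => Xs i om in
      let nd := (N %/ (6 * dd.+1))%N in
      forall W : nat -> 'I_N -> R,
        fw_run k xs (fun i => kme mu k (xs i)) W T ->
        (wce mu H ip xs (W T) <=
          (2 * Num.sqrt (limn (fun n => \sum_(dd <= j < n) sigma j))%R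
           + 4 * kappa k / nd%:R
           + 4 * kappa k / Num.sqrt (T%:R + 2))%R%:E)%E.
Proof.
move=> k_pd rkhs k_bd e_on _ sigma_ge0 mercer _ _ dN iid.
set n := (N %/ (6 * dd.+1))%N; have n0 : (0 < n)%N by rewrite divn_gt0 // muln_gt0.
have nN : (6 * dd.+1 * n <= N)%N by rewrite mulnC leq_divM.
have kap0 : 0 <= kappa k := kappa_ge0 k_bd.
have k_le x : k x x <= kappa k ^+ 2.
  by apply: kernel_diag_le_kappa k_bd _ _; exact: kernel_diag_ge0 sigma_ge0 mercer x.
have [E [mE PE goodE]] := iid_exists_good_weights e_on sigma_ge0 mercer kap0 k_le iid n0 nN.
exists E; split=> //; split=> // om Eom xs nd W run.
have [v v_simplex v_risk] := goodE om Eom.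
have k_norm := kernel_norm_le sigma_ge0 mercer k_le.
have W_risk := frank_wolfe_rate (embed_sq mu sigma e) (fun i j => k_pd.1 (xs i) (xs j))
  (fun u => pd_kernel_qform_ge0 xs u k_pd) (fun i j => k_norm (xs i) (xs j))
  (fun i => kme_norm_le e_on sigma_ge0 mercer k_le (xs i)) run v_simplex.
apply: le_trans (wce_le e_on sigma_ge0 mercer k_le rkhs xs (W T)) _; rewrite lee_fin.
have T2 : 0 < T%:R + 2 :> R by rewrite ltr_wpDl.
apply: sqrtr_le_add; rewrite ?addr_ge0 ?divr_ge0 ?mulr_ge0 ?sqrtr_ge0 //.
apply: le_trans W_risk _; apply: lerD; first exact: v_risk.
by rewrite expr_div_n sqr_sqrtr ?(ltW T2) // exprMn ler_pM2r ?invr_gt0 //; lra.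
Qed.
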